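(* Let $I$ be a homogeneous perfect ideal of height $2$ of $S=K[X_1,\dots,X_n]$. If $$e(I)<\frac{n(n+3)}{2},$$ then $I$ has a standard basis whose elements are all essential.
   Context: $K$ is an algebraically closed field, $S=K[X_1,\dots,X_n]$, $\mathfrak M=(X_1,\dots,X_n)$. An ideal is perfect of height $2$ if it has height $2$ and the projective dimension of $S/I$ is $2$. $e(I)$ is the multiplicity of $S/I$ (for $\dim S/I=0$, $e(I)=\dim_K S/I$). For a homogeneous ideal $I=\bigoplus_d I_d$, a standard basis of $I$ is an ordered set of forms generating $I$ such that its elements of degree $d$ define a $K$-basis of $I_d/(I_{d-1}S_1)$ for every $d$. Given a standard basis $\mathcal B$ of $I$, an element $f\in\mathcal B$ is inessential with respect to $\mathcal B$ if there is $t\in\mathbb N$ with $f\,\mathfrak M^t\subseteq(\mathcal B\setminus\{f\})S$; otherwise $f$ is essential. *)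

(* Defs.v *)
From HB Require Import structures.
From mathcomp Require Import all_boot all_order all_algebra.
From mathcomp Require Import generic_quotient ring_quotient.
From mathcomp Require Import classical_sets.
From mathcomp Require Export mpoly.

Set Implicit Arguments.
Unset Strict Implicit.
Unset Printing Implicit Defensive.

Import GRing.Theory.
Local Open Scope ring_scope.
Local Open Scope classical_set_scope.
Local Open Scope quotient_scope.

(* Proper ideals and prime ideals are the library's [idealr] and
   [prime_idealr]; membership there is boolean, which is no restriction
   classically.  Ideals that are built from others (generated ideals, products,
   powers) are [set]s. *)

Section Dimension.
Variable R : comNzRingType.

Definition prime_chain (k : nat) (c : nat -> prime_idealr R) : Prop :=
  forall i, (i < k)%N -> {subset c i <= c i.+1} /\ ~ {subset c i.+1 <= c i}.

Definition krull_dim (d : nat) : Prop :=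
  (exists c, prime_chain d c) /\ (forall k c, prime_chain k c -> (k <= d)%N).

Definition prime_height (P : prime_idealr R) (h : nat) : Prop :=
  (exists2 c, prime_chain h c & c h =i P) /\
  (forall k c, prime_chain k c -> c k =i P -> (k <= h)%N).

(* Primes of infinite height satisfy [prime_height P k] for no [k], so they
   rightly do not contribute to the minimum. *)
Definition ideal_height (I : idealr R) (h : nat) : Prop :=
  (exists2 P : prime_idealr R, {subset I <= P} & prime_height P h) /\
  (forall (P : prime_idealr R) k,
     {subset I <= P} -> prime_height P k -> (h <= k)%N).

End Dimension.

Section ProjectiveDimension.
Variable R : nzRingType.

Definition projective (P : lmodType R) : Prop :=
  forall (M N : lmodType R) (g : {linear M -> N}) (f : {linear P -> N}),
    (forall y, exists x, g x = y) ->
    exists h : {linear P -> M}, forall x, g (h x) = f x.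

Definition has_proj_resolution (M : lmodType R) (l : nat) : Prop :=
  exists (P : nat -> lmodType R) (d : forall i, {linear P i.+1 -> P i})
         (eps : {linear P 0%N -> M}),
    [/\ forall i, projective (P i),
        forall y, exists x, eps x = y,
        forall x, eps x = 0 <-> exists y, d 0%N y = x,
        forall i x, d i x = 0 <-> exists y, d i.+1 y = x
      & forall i, (l < i)%N -> forall x : P i, x = 0].

Definition proj_dim (M : lmodType R) (l : nat) : Prop :=
  has_proj_resolution M l /\
  (forall k, has_proj_resolution M k -> (l <= k)%N).

End ProjectiveDimension.

(* The R-module structure of R/I; the library only provides the ring. *)
Section QuotientModule.
Variables (R : comNzRingType) (I : idealr R).

Definition quot_scale (a : R) (x : {ideal_quot I}) : {ideal_quot I} :=
  \pi_{ideal_quot I} a * x.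

Fact quot_scaleA a b x :
  quot_scale a (quot_scale b x) = quot_scale (a * b) x.
Proof. by rewrite /quot_scale mulrA [in RHS]rmorphM. Qed.

Fact quot_scale1 : left_id 1 quot_scale.
Proof. by move=> x; rewrite /quot_scale rmorph1 mul1r. Qed.

Fact quot_scaleDr : right_distributive quot_scale +%R.
Proof. by move=> a x y; rewrite /quot_scale mulrDr. Qed.

Fact quot_scaleDl x : {morph quot_scale^~ x : a b / a + b}.
Proof. by move=> a b; rewrite /quot_scale rmorphD mulrDl. Qed.

HB.instance Definition _ := GRing.Zmodule_isLmodule.Build R {ideal_quot I}
  quot_scaleA quot_scale1 quot_scaleDr quot_scaleDl.

End QuotientModule.

Definition perfect_of_height (R : comNzRingType) (h : nat) (I : idealr R) :
    Prop :=
  ideal_height I h /\ proj_dim ({ideal_quot I} : lmodType R) h.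

Section Generated.
Variable R : comNzRingType.

Definition sums (A : set R) : set R :=
  [set p | exists2 s : seq R, {in s, forall x, A x} & p = \sum_(x <- s) x].

Definition ideal_gen (A : set R) : set R :=
  sums [set a * x | a in setT & x in A].

Definition ideal_mul (J L : set R) : set R :=
  sums [set x * y | x in J & y in L].

Definition ideal_pow (J : set R) (t : nat) : set R := iter t (ideal_mul J) setT.

End Generated.

(* For subspaces W <= V: the family b lies in V and its classes form a basis
   of V/W.  More generally W need not lie in V, and then V/W is to be read as
   V/(V :&: W). *)
Definition basis_mod (F : fieldType) (E : lmodType F) (V W : set E)
    (b : seq E) : Prop :=
  [/\ {in b, forall v, V v},
      forall v, V v ->
        exists c : 'I_(size b) -> F, W (v - \sum_i c i *: b`_i)
    & forall c : 'I_(size b) -> F,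
        W (\sum_i c i *: b`_i) -> forall i, c i = 0].

Section Graded.
Variables (K : fieldType) (n : nat).
Notation S := {mpoly K[n]}.

Definition forms (d : nat) : set S := [set p | p \is d.-homog].

Definition irrelevant_ideal : set S := ideal_gen (range (fun i : 'I_n => 'X_i)).

Section Ideal.
Variable I : idealr S.

Definition homogeneous_ideal : Prop :=
  forall p d, p \in I -> pihomog mdeg d p \in I.

Definition forms_in (d : nat) : set S := [set` I] `&` forms d.

(* I_(d-1) S_1, with I_(-1) = 0. *)
Definition lower_forms (d : nat) : set S :=
  if d is k.+1 then sums [set f * g | f in forms_in k & g in forms 1]
  else [set 0].

Definition hilbert_function (d h : nat) : Prop :=
  exists2 b, basis_mod (forms d) [set` I] b & h = size b.

Definition hilbert_polynomial (P : {poly rat}) : Prop :=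
  exists N, forall d, (N <= d)%N ->
    exists2 h, hilbert_function d h & P.[d%:R] = h%:R.

(* (d-1)! times the coefficient of degree d-1 of the Hilbert polynomial, where
   d = dim S/I; the K-dimension of S/I if d = 0. *)
Definition multiplicity (e : rat) : Prop :=
  exists2 d, krull_dim {ideal_quot I} d &
    if d is k.+1 then
      exists2 P, hilbert_polynomial P & e = k`!%:R * P`_k
    else exists2 b : seq S, basis_mod setT [set` I] b & e = (size b)%:R.

Definition standard_basis (B : seq S) : Prop :=
  [/\ uniq B,
      {in B, forall f, exists d, f \is d.-homog},
      ideal_gen [set` B] = [set` I]
    & forall d,
        basis_mod (forms_in d) (lower_forms d) [seq f <- B | f \is d.-homog]].

End Ideal.

Definition inessential (B : seq S) (f : S) : Prop :=
  exists t, forall g, ideal_pow irrelevant_ideal t g ->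
    ideal_gen ([set` B] `\ f) (f * g).

Definition essential (B : seq S) (f : S) : Prop := ~ inessential B f.

End Graded.

(* Main.v *)
From HB Require Import structures.
Require Import Defs.
From mathcomp Require Import all_boot all_order all_algebra.
From mathcomp Require Import ring_quotient mpoly.
From mathcomp Require Import boolp classical_sets.
From mathcomp Require Import ring lra zify.

Set Implicit Arguments.
Unset Strict Implicit.
Unset Printing Implicit Defensive.

Import Order.TTheory GRing.Theory Num.Theory.
Local Open Scope ring_scope.

(** Let [f_1, ..., f_m] be homogeneous generators of [I], as few as possible, and
    [z_1, ..., z_q] homogeneous generators, as few as possible, of the module of
    their syzygies; let [a_i] and [b_j] be the degrees, in increasing order, and
    [a = a_1]. Since [S/I] has projective dimension two, the [z_j] are linearly
    independent ([kernel_retract], [syzygies_free]), and the Hilbert function of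
    [S/I] is an alternating sum of binomial coefficients in [d - a_i] and
    [d - b_j] ([hilbert_function_resolution]). Height two means that the
    corresponding polynomial has degree [n - 3], whence [q = m - 1] and
    [sum b_j = sum a_i] ([moments_eq0]); its leading coefficient then gives
    [2 e = sum b_j^2 - sum a_i^2] ([multiplicity_moment]).

    Two mechanisms make a generator essential. First, [f_i] is essential as soon
    as some nonzero point of [K^n] is a zero of all other generators but not of
    [f_i]: evaluate. Replacing the generators by others of the same degrees, such
    points can be found for every generator of the least degree [a]
    ([min_gens_points]). Secondly, the multipliers of [f_i] into the ideal of the
    other generators are the combinations of the [i]-th entries of the [z_j]. The
    entry of [z_j] is zero unless [b_j > a_i], and at least [n] forms of positive
    degree are needed to generate an ideal that contains a power of the
    irrelevant ideal ([irrelevant_power_generators]). So an inessential [f_i]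
    forces [b_j > a_i] for at least [n] indices [j] ([inessential_card]).

    It remains to exclude an inessential [f_i] with [a_i > a]. Independence of the
    syzygies gives [b_j > a_(j+1)] ([card_syzygies_lt]): otherwise
    [z_1, ..., z_j] would be relations among [f_1, ..., f_j] only, and a square
    matrix annihilating a nonzero vector has dependent rows. Put
    [u_j = b_j - a_(j+1) >= 1]. Then [sum u_j = a], so [a >= q >= n], and
    [2 e = sum u_j (2 a_(j+1) + u_j) - a^2 >= a^2 + a]. If [a > n], this exceeds
    [n (n + 3)]. If [a = n], then [q = n], all [u_j] are 1, all [b_j] are at least
    [a + 2], so all [a_(j+1)] are at least [a + 1], and the formula gives
    [2 e >= a^2 + 3 a = n (n + 3)]. Both contradict the bound on [e].

    Krull dimension and height are compared with Hilbert functions through the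
    growth, as [t] increases, of the number of elements of degree less than [t]
    that are independent modulo an ideal. This growth gets strictly larger when
    a prime is replaced by a smaller one ([growth_nonzerodivisor]), so it bounds
    chains of primes; conversely, a homogeneous ideal of growth [r] lies in a
    homogeneous prime of growth [r], and cutting with a variable produces a chain
    of [r] further primes above it ([exists_prime_chain]). *)

(** * Bases modulo a subspace *)

Lemma sum_option (V : nmodType) (T : finType) (F : option T -> V) :
  \sum_o F o = F None + \sum_t F (Some t).
Proof.
rewrite (bigD1 None) //=; congr (_ + _).
rewrite (reindex_omap Some id) => [|[]//].
by apply: eq_bigl => t; rewrite eqxx.
Qed.

Section Families.
Variables (K : fieldType) (E : lmodType K).
Implicit Types (V W : set E).

Definition subspace W := W 0 /\ forall a x y, W x -> W y -> W (a *: x + y).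

Definition lincomb (T : finType) (b : T -> E) (c : T -> K) := \sum_t c t *: b t.

Definition indep (T : finType) W (b : T -> E) :=
  forall c, W (lincomb b c) -> forall t, c t = 0.

Definition spanmod (T : finType) W (b : T -> E) v := exists c, W (v - lincomb b c).

(** Families indexed by an arbitrary finite type rather than sequences, so that
    bases can be concatenated along sums and sigma types. *)
Definition fbasis (T : finType) V W (b : T -> E) :=
  [/\ forall t, V (b t), forall v, V v -> spanmod W b v & indep W b].

Section Subspace.
Variable W : set E.
Hypothesis subW : subspace W.

Lemma subspace0 : W 0. Proof. by case: subW. Qed.

Lemma subspaceZ a x : W x -> W (a *: x).
Proof. by move=> Wx; rewrite -[_ *: _]addr0; apply: subW.2 => //; apply: subW.1. Qed.

Lemma subspaceD x y : W x -> W y -> W (x + y).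
Proof. by move=> Wx Wy; rewrite -[x]scale1r; apply: subW.2. Qed.

Lemma subspaceN x : W x -> W (- x).
Proof. by move=> Wx; rewrite -scaleN1r; apply: subspaceZ. Qed.

Lemma subspaceB x y : W x -> W y -> W (x - y).
Proof. by move=> Wx Wy; apply: subspaceD => //; apply: subspaceN. Qed.

Lemma subspace_sum (T : Type) (r : seq T) (P : pred T) (F : T -> E) :
  (forall t, P t -> W (F t)) -> W (\sum_(t <- r | P t) F t).
Proof. by move=> WF; apply: (big_ind W) => //; [exact: subspace0|exact: subspaceD]. Qed.

Lemma subspace_lincomb (T : finType) (b : T -> E) c :
  (forall t, W (b t)) -> W (lincomb b c).
Proof. by move=> Wb; apply: subspace_sum => t _; apply: subspaceZ. Qed.

Lemma spanmod_sub (T : finType) (b : T -> E) : subspace (spanmod W b).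
Proof.
split; first by exists (fun=> 0); rewrite /lincomb big1 ?subr0; [exact: subspace0|move=> i _; rewrite scale0r].
move=> a x y [c Wc] [e We]; exists (fun t => a * c t + e t).
have -> : a *: x + y - lincomb b (fun t => a * c t + e t)
        = a *: (x - lincomb b c) + (y - lincomb b e).
  rewrite scalerBr addrACA -opprD; congr (_ - _).
  rewrite /lincomb scaler_sumr -big_split; apply: eq_bigr => t _.
  by rewrite scalerDl scalerA.
exact: subW.2.
Qed.

Lemma spanmod_mod (T : finType) (b : T -> E) w : W w -> spanmod W b w.
Proof.
by move=> Ww; exists (fun=> 0); rewrite /lincomb big1 ?subr0 // => i _; rewrite scale0r.
Qed.

Lemma spanmod_mem (T : finType) (b : T -> E) t : spanmod W b (b t).
Proof.
exists (fun s => (s == t)%:R); rewrite /lincomb (bigD1 t) //= eqxx scale1r big1.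
  by rewrite addr0 subrr; apply: subspace0.
by move=> s /negPf ->; rewrite scale0r.
Qed.

(** If the coefficient matrix of one family in terms of another has more rows
    than columns, a vector of its left kernel is a relation modulo [W]. *)
Lemma indep_leq (T1 T2 : finType) (b1 : T1 -> E) (b2 : T2 -> E) :
  indep W b1 -> (forall t, spanmod W b2 (b1 t)) -> (#|T1| <= #|T2|)%N.
Proof.
move=> ib /choice[A WA]; rewrite leqNgt; apply/negP => lt21.
pose M := \matrix_(i < #|T1|, j < #|T2|) A (enum_val i) (enum_val j).
have /rowV0Pn[v /sub_kermxP vM0 /negP[]] : kermx M != 0.
  by rewrite -mxrank_eq0 mxrank_ker subn_eq0 -ltnNge (leq_ltn_trans (rank_leq_col M)).
pose c t := v 0 (enum_rank t).
suff c0 t : c t = 0.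
  apply/eqP/rowP => i; rewrite mxE -[RHS](c0 (enum_val i)).
  by rewrite /c enum_valK.
apply: ib.
have -> : lincomb b1 c = lincomb (fun t => b1 t - lincomb b2 (A t)) c.
  rewrite /lincomb; under [RHS]eq_bigr do rewrite scalerBr.
  rewrite sumrB [X in _ - X](_ : _ = 0) ?subr0 //.
  under eq_bigr do rewrite scaler_sumr.
  rewrite exchange_big big1 // => s _ /=.
  under eq_bigr do rewrite scalerA.
  rewrite -scaler_suml [X in X *: _](_ : _ = (v *m M) 0 (enum_rank s)).
    by rewrite vM0 mxE scale0r.
  rewrite mxE (reindex (@enum_val T1 predT)) /=; last exact/onW_bij/enum_val_bij.
  by apply: eq_bigr => i _; rewrite mxE enum_rankK /c enum_valK.
exact: subspace_lincomb.
Qed.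

Lemma indep_bij (T1 T2 : finType) (h : T1 -> T2) (b : T2 -> E) :
  bijective h -> indep W b -> indep W (b \o h).
Proof.
move=> bh ib c Wc t; case: (bh) => g hK gK.
have -> : c t = c (g (h t)) by rewrite hK.
apply: (ib (c \o g)); rewrite (_ : lincomb _ _ = lincomb (b \o h) c) //.
rewrite /lincomb (reindex h) /=; last exact/onW_bij.
by apply: eq_bigr => i _; rewrite hK.
Qed.

Lemma spanmod_bij (T1 T2 : finType) (h : T1 -> T2) (b : T2 -> E) v :
  bijective h -> spanmod W b v -> spanmod W (b \o h) v.
Proof.
move=> bh [c Wc]; exists (c \o h).
rewrite (_ : lincomb _ _ = lincomb b c) //.
by rewrite /lincomb [RHS](reindex h) //=; apply/onW_bij.
Qed.

Lemma fbasis_bij (T1 T2 : finType) V (h : T1 -> T2) (b : T2 -> E) :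
  bijective h -> fbasis V W b -> fbasis V W (b \o h).
Proof.
move=> bh [Vb sb ib]; split => [t|v Vv|]; first exact: Vb.
  exact/(spanmod_bij bh)/sb.
exact: indep_bij.
Qed.

Lemma fbasis_card (T1 T2 : finType) V (b1 : T1 -> E) (b2 : T2 -> E) :
  fbasis V W b1 -> fbasis V W b2 -> #|T1| = #|T2|.
Proof.
move=> [V1 s1 i1] [V2 s2 i2]; apply/eqP; rewrite eqn_leq; apply/andP; split.
  by apply: (indep_leq i1) => t; apply: s2.
by apply: (indep_leq i2) => t; apply: s1.
Qed.

(** A largest independent family spans. *)
Lemma exists_fbasis V N :
  (forall k (b : 'I_k -> E), (forall i, V (b i)) -> indep W b -> (k <= N)%N) ->
  exists k (b : 'I_k -> E), fbasis V W b.
Proof.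
move=> bound.
pose P k := `[< exists2 b : 'I_k -> E, (forall i, V (b i)) & indep W b >].
have P0 : exists k, P k by exists 0%N; apply/asboolP; exists (fun=> 0) => [[]//|c _ []].
have PN k : P k -> (k <= N)%N by move/asboolP => [b]; exact: bound.
case: (ex_maxnP P0 PN) => k /asboolP[b Vb ib] kmax.
exists k, b; split => // v Vv; apply: contrapT => nsv.
suff /kmax : P #|{: option 'I_k}| by rewrite card_option card_ord ltnn.
pose b' (o : option 'I_k) := if o is Some i then b i else v.
apply/asboolP; exists (b' \o enum_val).
  by move=> i /=; case: (enum_val i).
apply: indep_bij; first exact: enum_val_bij.
move=> c; rewrite /lincomb sum_option /= => Wc.
have cN : c None = 0.
  apply: contrapT => /eqP cN; apply: nsv.
  exists (fun i => - (c None)^-1 * c (Some i)).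
  have /(subspaceZ (c None)^-1) := Wc.
  rewrite scalerDr scalerA mulVf // scale1r /lincomb -sumrN scaler_sumr.
  congr (W (_ + _)); apply: eq_bigr => i _.
  by rewrite scalerA mulNr scaleNr opprK.
rewrite cN scale0r add0r in Wc.
by case=> [i|//]; apply: (ib (c \o Some)).
Qed.

End Subspace.

Lemma fbasis_basis_mod (T : finType) V W (b : T -> E) :
  subspace W -> fbasis V W b -> basis_mod V W [seq b t | t <- enum T].
Proof.
move=> sW fb; set s := map _ _.
have szs : size s = #|T| by rewrite size_map cardE.
pose h (i : 'I_(size s)) : T := enum_val (cast_ord szs i).
have bh : bijective h.
  by exists (cast_ord (esym szs) \o enum_rank) => i; rewrite /h /= ?enum_valK ?cast_ordKV ?cast_ordK ?enum_rankK.
have sE (i : 'I_(size s)) : s`_i = (b \o h) i.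
  have x0 : T := h i.
  rewrite /= /h /s (nth_map x0) /=; last by rewrite -cardE -szs.
  by rewrite (enum_val_nth x0).
have [Vb sb ib] := fbasis_bij bh fb.
have sumE c : \sum_(i < size s) c i *: s`_i = lincomb (b \o h) c.
  by apply: eq_bigr => i _; rewrite sE.
split => [v|v Vv|c].
- by move=> /mapP[t _ ->]; case: fb.
- by have [c Wc] := sb _ Vv; exists c; rewrite sumE.
- by rewrite sumE => /ib.
Qed.

Lemma basis_mod_fbasis V W (s : seq E) :
  basis_mod V W s -> fbasis V W (fun i : 'I_(size s) => s`_i).
Proof.
by move=> [Vs ss si]; split => [i|v Vv|c Wc]; [apply/Vs/mem_nth|exact: ss|exact: si].
Qed.

End Families.

Arguments indep_leq {K E W} _ {T1 T2 b1 b2}.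

Section RankNullity.
Variables (K : fieldType) (E E' : lmodType K) (phi : {linear E -> E'}).

Lemma lincomb_linear (T : finType) (b : T -> E) c :
  phi (lincomb b c) = lincomb (phi \o b) c.
Proof. by rewrite linear_sum; apply: eq_bigr => t _; rewrite linearZ. Qed.

Lemma zero_subspace : subspace [set 0 : E].
Proof. by split => // a x y -> ->; rewrite scaler0 addr0. Qed.

Lemma lincomb_sum (T1 T2 : finType) (b1 : T1 -> E) (b2 : T2 -> E)
  (c : T1 + T2 -> K) :
  lincomb (fun t => match t with inl x => b1 x | inr y => b2 y end) c
  = lincomb b1 (c \o inl) + lincomb b2 (c \o inr).
Proof. by rewrite /lincomb big_sumType. Qed.

Lemma fbasis_cat (T1 T2 : finType) (V W U : set E) (b1 : T1 -> E) (b2 : T2 -> E) :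
  subspace V -> subspace W -> (forall x, U x -> W x) -> (forall x, W x -> V x) ->
  fbasis V W b1 -> fbasis W U b2 ->
  fbasis V U (fun t => match t with inl x => b1 x | inr y => b2 y end).
Proof.
move=> sV sW UW WV [V1 s1 i1] [W2 s2 i2]; split.
- by case=> t; [exact: V1|exact/WV/W2].
- move=> v /s1[c1 /s2[c2 Uc]].
  exists (fun t => match t with inl x => c1 x | inr y => c2 y end).
  by rewrite lincomb_sum opprD addrA.
- move=> c; rewrite lincomb_sum => Uc.
  have c1 : forall t, (c \o inl) t = 0.
    apply: i1; rewrite -[lincomb _ _](addrK (lincomb b2 (c \o inr))).
    apply: (subspaceB sW); first exact: UW.
    exact: subspace_lincomb.
  have := Uc; rewrite [lincomb b1 _]big1 ?add0r; last by move=> t _; rewrite c1 scale0r.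
  by move=> /i2 c2; case=> t; [exact: c1|exact: c2].
Qed.

Lemma fbasis_quot (T : finType) (V W : set E) (b : T -> E) :
  subspace W -> fbasis V [set 0] b ->
  exists k (b' : 'I_k -> E), fbasis V W b'.
Proof.
move=> sW [Vb sb ib]; apply: (@exists_fbasis _ _ _ sW _ #|T|).
move=> k b' Vb' ib'; rewrite -[k]card_ord.
have sp t : spanmod W b (b' t).
  by have [c e] := sb _ (Vb' t); exists c; rewrite (e : _ = 0); apply: subspace0.
exact: (indep_leq sW ib' sp).
Qed.

(** A basis of [V] modulo the kernel maps to a basis of the image. *)
Lemma rank_nullity (T T' : finType) (V : set E) (b : T -> E) (b' : T' -> E) :
  subspace V -> fbasis V [set 0] b ->
  fbasis [set x | V x /\ phi x = 0] [set 0] b' ->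
  exists2 k, exists b'' : 'I_k -> E', fbasis [set phi x | x in V] [set 0] b'' & (k + #|T'| = #|T|)%N.
Proof.
move=> sV fV fZ; set Z := (X in fbasis X _ b') in fZ.
have sZ : subspace Z.
  split; first by split; [exact: subspace0|rewrite linear0].
  move=> a x y [Vx x0] [Vy y0]; split; first exact: sV.2.
  by rewrite linearP x0 y0 scaler0 addr0.
have [k [c fc]] := fbasis_quot sZ fV.
exists k.
  exists (phi \o c); have [Vc sc ic] := fc; split.
  - by move=> t; exists (c t).
  - move=> _ [x /sc[e [_ /eqP ex]] <-]; move: ex; rewrite linearB subr_eq0 => /eqP ex.
    by exists e; rewrite ex lincomb_linear subrr.
  - move=> e /= e0; apply: ic; split; first exact: subspace_lincomb.
    by rewrite lincomb_linear.
have fall : fbasis V [set 0] (fun t => match t with inl x => c x | inr y => b' y end).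
  apply: (fbasis_cat sV sZ _ _ fc fZ); last by move=> x [].
  by move=> x ->; exact: subspace0.
have := fbasis_card zero_subspace fall fV.
by rewrite card_sum card_ord.
Qed.

End RankNullity.

(** * Finite generation *)

Section Dickson.
Variable n : nat.

(** An element [b] of [A] that is not above a fixed [a] in [A] has [b i = v]
    for some coordinate [i] and some [v < a i], which leaves finitely many
    slices of [A] with one free coordinate less. *)
Lemma dickson_free (D : {set 'I_n}) (A : set 'X_{1..n}) :
  (forall a b, A a -> A b -> forall i, i \notin D -> a i = b i) ->
  exists2 s : seq 'X_{1..n}, {in s, forall m, A m} &
    forall m, A m -> exists2 m', m' \in s & (m' <= m)%MM.
Proof.
move: {2}#|D| (leqnn #|D|) => k; elim: k D A => [|k IH] D A leDk agree.
  have [[a Aa]|nA] := pselect (exists a, A a); last first.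
    by exists [::] => // m Am; case: nA; exists m.
  exists [:: a]; first by move=> m; rewrite inE => /eqP ->.
  move=> m Am; exists a; rewrite ?inE //; apply/mnm_lepP => i.
  rewrite (agree a m) //; move: leDk; rewrite leqn0 cards_eq0 => /eqP ->.
  by rewrite inE.
have [[a Aa]|nA] := pselect (exists a, A a); last first.
  by exists [::] => // m Am; case: nA; exists m.
have slice (p : 'I_n * nat) : exists s : seq 'X_{1..n}, p.1 \in D ->
    {in s, forall m, A m} /\
    forall m, A m -> m p.1 = p.2 -> exists2 m', m' \in s & (m' <= m)%MM.
  case: p => i v /=; have [iD|/negP niD] := boolP (i \in D); last by exists [::].
  have [||s sA sP] := IH (D :\ i) [set m | A m /\ m i = v]%classic.
  - by rewrite -ltnS (leq_trans _ leDk) // [in leqRHS](cardsD1 i) iD.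
  - move=> b c [Ab <-] [Ac bc] j; rewrite !inE negb_and negbK.
    by case/orP => [/eqP -> //|]; apply: agree.
  by exists s; split=> [m /sA[]//|m Am mv]; apply: sP.
have /choice[s sP] := slice.
exists (a :: flatten [seq s p | p <- [seq (i, v) | i <- enum D, v <- iota 0 (a i)]]).
  move=> m; rewrite inE => /orP[/eqP -> //|/flatten_mapP[p]].
  move=> /allpairsPdep[i [v [iD _ ->]]]; rewrite mem_enum in iD.
  by have [sA _] := sP (i, v) iD; apply: sA.
move=> m Am; have [le_am|] := boolP (a <= m)%MM.
  by exists a; rewrite ?mem_head.
rewrite negb_forall => /existsP[i]; rewrite -ltnNge => lt_ma.
have iD : i \in D.
  by apply: contraLR lt_ma => /(agree a m Aa Am) ->; rewrite ltnn.
have [_ /(_ m Am erefl)[m' m's lem]] := sP (i, m i) iD.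
exists m' => //; rewrite inE; apply/orP; right; apply/flatten_mapP.
exists (i, m i) => //; apply/allpairsPdep; exists i, (m i).
by rewrite mem_enum iD mem_iota.
Qed.

Lemma dickson (A : set 'X_{1..n}) :
  exists2 s : seq 'X_{1..n}, {in s, forall m, A m} &
    forall m, A m -> exists2 m', m' \in s & (m' <= m)%MM.
Proof. by apply: (@dickson_free [set: 'I_n]) => a b _ _ i; rewrite inE. Qed.

End Dickson.

Section Noether.
Variables (K : fieldType) (n : nat).
Notation S := {mpoly K[n]}.

Definition ideal_set (J : set S) :=
  J 0 /\ forall a x y, J x -> J y -> J (a * x + y).

Section IdealSet.
Variable J : set S.
Hypothesis idJ : ideal_set J.

Lemma ideal_set0 : J 0. Proof. by case: idJ. Qed.

Lemma ideal_setM a x : J x -> J (a * x).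
Proof. by move=> Jx; rewrite -[_ * _]addr0; apply: idJ.2 => //; apply: ideal_set0. Qed.

Lemma ideal_setD x y : J x -> J y -> J (x + y).
Proof. by move=> Jx Jy; rewrite -[x]mul1r; apply: idJ.2. Qed.

Lemma ideal_set_sub : subspace J.
Proof.
split; first exact: ideal_set0.
by move=> a x y Jx Jy; rewrite -mul_mpolyC; apply: idJ.2.
Qed.

End IdealSet.

Definition span_ideal (T : finType) (f : T -> S) : set S :=
  [set p | exists c : T -> S, p = \sum_t c t * f t]%classic.

(** By Dickson's lemma the leading monomials of [J] are multiples of those of
    finitely many elements; subtracting a multiple of one of them lowers the
    leading monomial. *)
Lemma hilbert_basis (J : set S) : ideal_set J ->
  exists (T : finType) (f : T -> S), (forall t, J (f t)) /\ forall p, J p -> span_ideal f p.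
Proof.
move=> idJ.
have [s sA sP] := dickson [set mlead p | p in [set p | J p /\ p != 0]]%classic.
have : forall m : seq_sub s, exists p, [/\ J p, p != 0 & mlead p = val m].
  by case=> m ms /=; have [p [Jp p0] <-] := sA _ ms; exists p.
move=> /choice[f fP]; exists (seq_sub s), f; split; first by move=> t; case: (fP t).
elim/mleadrect => p IH Jp.
have [->|p0] := eqVneq p 0.
  by exists (fun=> 0); rewrite big1 // => t _; rewrite mul0r.
have [|m ms le_mp] := sP (mlead p); first by exists p.
pose t := SeqSub ms; have [Jt t0 tm] := fP t; rewrite /= in tm.
pose a : S := ((mleadc p / mleadc (f t)) *: 'X_[mlead p - m])%MM.
have lt0 : mleadc (f t) != 0 by rewrite mleadc_eq0.
have lp0 : mleadc p != 0 by rewrite mleadc_eq0.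
have a0 : a != 0.
  by rewrite scaler_eq0 negb_or mulf_neq0 ?invr_eq0 // -msupp_eq0 msuppX.
have la : mlead a = (mlead p - m)%MM.
  by rewrite mleadZ ?mleadXm // mulf_neq0 ?invr_eq0.
have lat : mlead (a * f t) = mlead p by rewrite mleadM // la tm submK.
have lc : mleadc (a * f t) = mleadc p.
  rewrite lat -{1}lat mleadM // mleadcM la mcoeffZ mcoeffX eqxx mulr1.
  by rewrite divfK.
have [eq_p|neq_p] := eqVneq (p - a * f t) 0.
  exists (fun u => if u == t then a else 0); rewrite (bigD1 t) //= eqxx big1.
    by rewrite addr0; apply/eqP; rewrite -subr_eq0 eq_p.
  by move=> u /negPf ->; rewrite mul0r.
have [||c pc] := IH (p - a * f t).
- rewrite lt_neqAle; apply/andP; split; last first.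
    by apply: le_trans (mleadB_le _ _) _; rewrite lat joinxx.
  apply: contra neq_p => /eqP e; rewrite -mleadc_eq0 e mcoeffB.
  by rewrite -[X in _ - _@_X]lat lc subrr.
- rewrite addrC -mulNr; exact: idJ.2.
exists (fun u => c u + if u == t then a else 0).
rewrite -[LHS](subrK (a * f t)) pc; under [RHS]eq_bigr do rewrite mulrDl.
rewrite big_split /=; congr (_ + _); rewrite (bigD1 t) //= eqxx big1 ?addr0 //.
by move=> u /negPf ->; rewrite mul0r.
Qed.

End Noether.

(** * Graded submodules of free modules *)

Section Submodules.
Variables (K : fieldType) (n m : nat).
Notation S := {mpoly K[n]}.
Notation V := {ffun 'I_m -> S}.
Implicit Types (U : set V) (u v : V).

Definition vscale (c : S) (u : V) : V := [ffun i => c * u i].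

(** Submodules for the scalars in [S]: the canonical module structure of the
    finite functions has its scalars in [K]. *)
Definition submodule U := U 0 /\ forall c u v, U u -> U v -> U (vscale c u + v).

Definition vcomb (T : finType) (g : T -> V) (c : T -> S) : V := \sum_t vscale (c t) (g t).

Lemma vcombE (T : finType) (g : T -> V) c i : vcomb g c i = \sum_t c t * g t i.
Proof. by rewrite sum_ffunE; apply: eq_bigr => t _; rewrite ffunE. Qed.

Lemma submoduleZ U c u : submodule U -> U u -> U (vscale c u).
Proof. by move=> [U0 Ul] Uu; rewrite -[vscale c u]addr0; apply: Ul. Qed.

Lemma submoduleD U u v : submodule U -> U u -> U v -> U (u + v).
Proof.
move=> [_ Ul] Uu Uv; rewrite (_ : u = vscale 1 u); first exact: Ul.
by apply/ffunP => i; rewrite ffunE mul1r.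
Qed.

Lemma submodule_comb U (T : finType) (g : T -> V) c :
  submodule U -> (forall t, U (g t)) -> U (vcomb g c).
Proof.
move=> sU Ug; apply: (big_ind U); [by case: sU|by move=> *; apply: submoduleD|].
by move=> t _; apply: submoduleZ.
Qed.

Definition generates (T : finType) U (g : T -> V) :=
  (forall t, U (g t)) /\ forall u, U u -> exists c, u = vcomb g c.

(** The entries in the last coordinate form an ideal; after subtracting a
    combination of lifts of its generators, one coordinate less is left. *)
Lemma submodule_fg_support k U :
  submodule U -> (forall u, U u -> forall i : 'I_m, (k <= i)%N -> u i = 0) ->
  exists (T : finType) (g : T -> V), generates U g.
Proof.
elim: k U => [|k IH] U sU U0.
  exists void, (fun=> 0); split=> [[]//|u Uu]; exists (fun=> 0); apply/ffunP => i.
  by rewrite (U0 _ Uu) // vcombE big1 // => -[].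
have [ltkm|lemk] := ltnP k m; last first.
  by apply: IH => // u Uu i ki; have := leq_trans lemk ki; rewrite leqNgt ltn_ord.
pose i0 := Ordinal ltkm.
have [|T [f [Jf fP]]] := @hilbert_basis _ _ [set p | exists2 u, U u & u i0 = p]%classic.
  split; first by exists 0; [case: sU|rewrite ffunE].
  move=> a _ _ [u Uu <-] [v Uv <-]; exists (vscale a u + v); last by rewrite !ffunE.
  by apply: sU.2.
have /choice[g gP] : forall t, exists u, U u /\ u i0 = f t.
  by move=> t; have [u Uu e] := Jf t; exists u.
pose U' := [set u | U u /\ u i0 = 0]%classic.
have [||T' [g' [Ug' g'P]]] := IH U'.
- split; first by split; [case: sU|rewrite ffunE].
  move=> c u v [Uu u0] [Uv v0]; split; first exact: sU.2.
  by rewrite !ffunE u0 v0 mulr0 addr0.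
- move=> u [Uu u0] i; rewrite leq_eqVlt => /orP[/eqP ki|]; last exact: U0.
  by rewrite (_ : i = i0) //; apply: val_inj.
exists (T + T')%type, (fun x => match x with inl t => g t | inr t => g' t end).
split; first by case=> t; [case: (gP t)|case: (Ug' t)].
move=> u Uu; have [|c uc] := fP (u i0); first by exists u.
have [|c' uc'] := g'P (u - vcomb g c).
  split; last first.
    rewrite !ffunE vcombE uc; apply/eqP; rewrite subr_eq0.
    by apply/eqP/eq_bigr => t _; case: (gP t) => _ ->.
  rewrite addrC (_ : - vcomb g c = vscale (-1) (vcomb g c)); last first.
    by apply/ffunP => i; rewrite !ffunE mulN1r.
  by apply: sU.2 => //; apply: submodule_comb => // t; case: (gP t).
exists (fun x => match x with inl t => c t | inr t => c' t end).
by rewrite /vcomb big_sumType /= -[u](subrK (vcomb g c)) uc' addrC.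
Qed.

Lemma submodule_fg U : submodule U -> exists (T : finType) (g : T -> V), generates U g.
Proof.
by move=> sU; apply: (@submodule_fg_support m) => // u _ i; rewrite leqNgt ltn_ord.
Qed.

End Submodules.

Section Parts.
Variables (K : fieldType) (n : nat).
Notation S := {mpoly K[n]}.
Implicit Types (p q f : S) (d e : nat).

(** The part of degree [d - e], read as 0 when [d < e]: what a coefficient of a
    generator of degree [e] contributes in degree [d]. *)
Definition hpart d e p : S := if (e <= d)%N then pihomog mdeg (d - e) p else 0.

Definition homog_shift d e p := if (e <= d)%N then p \is (d - e).-homog else p == 0.

Lemma hpart_homog d e p : homog_shift d e (hpart d e p).
Proof. by rewrite /hpart /homog_shift; case: (e <= d)%N; rewrite ?eqxx ?pihomogP. Qed.

Lemma hpart_id d e p : homog_shift d e p -> hpart d e p = p.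
Proof.
by rewrite /hpart /homog_shift; case: (e <= d)%N => [/pihomog_dE|/eqP].
Qed.

Lemma hpartD d e : {morph hpart d e : p q / p + q}.
Proof. by move=> p q; rewrite /hpart; case: ifP; rewrite ?addr0 // linearD. Qed.

Lemma hpart0 d e : hpart d e 0 = 0.
Proof. by rewrite /hpart; case: ifP; rewrite // linear0. Qed.

Lemma hpart_sum d e (T : Type) (r : seq T) (P : pred T) (F : T -> S) :
  hpart d e (\sum_(t <- r | P t) F t) = \sum_(t <- r | P t) hpart d e (F t).
Proof. by apply: (big_morph _ (@hpartD d e) (@hpart0 d e)). Qed.

Lemma pihomogMl d e p f : f \is e.-homog -> pihomog mdeg d (p * f) = hpart d e p * f.
Proof.
move=> hf; rewrite [p in LHS](pihomog_partitionE (mf := mdeg) (leqnn (msize p))).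
rewrite mulr_suml linear_sum /=.
have hM k : pihomog mdeg k p * f \is (k + e).-homog by apply: dhomogM => //; apply: pihomogP.
rewrite /hpart; case: ifP => [le_ed|]; last first.
  move=> /negbT; rewrite -ltnNge => lt_da.
  rewrite mul0r big1 // => k _; apply: pihomog_ne0 (hM k).
  by apply/eqP; lia.
have [lt|ge] := ltnP (d - e) (msize p).
  rewrite (bigD1 (Ordinal lt)) //= big1 ?addr0.
    by rewrite pihomog_dE // -{2}(subnK le_ed).
  move=> k nk; apply: pihomog_ne0 (hM k); apply: contra nk => /eqP ek.
  by apply/eqP/val_inj => /=; lia.
have -> : pihomog mdeg (d - e) p = 0.
  rewrite pihomogE big_seq_cond big1 // => b /andP[/msize_mdeg_lt lb /eqP eb].
  by move: lb; rewrite eb ltnNge ge.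
rewrite mul0r big1 // => k _; apply: pihomog_ne0 (hM k).
by apply/eqP => ek; have := ltn_ord k; lia.
Qed.

(** Extracting degree [d - a] from the product of [p] with a form of degree
    [e - a] amounts to extracting degree [d - e] from [p]. *)
Lemma hpartMl d e a p f : homog_shift e a f -> hpart d a (p * f) = hpart d e p * f.
Proof.
rewrite /homog_shift; case: ifP => [lae hf|_ /eqP ->]; last by rewrite !mulr0 hpart0.
rewrite {1}/hpart; case: ifP => [lad|/negbT nad]; last first.
  by rewrite /hpart ifF ?mul0r //; apply/negbTE; lia.
rewrite (pihomogMl _ _ hf) /hpart.
have -> : (e - a <= d - a)%N = (e <= d)%N by lia.
by case: ifP => // led; rewrite (_ : d - a - (e - a) = d - e)%N //; lia.
Qed.

Lemma hpart_partition e p k : (msize p <= k)%N -> p = \sum_(d < e + k) hpart d e p.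
Proof.
move=> lk; rewrite big_split_ord /= big1 ?add0r; last first.
  by move=> i _; rewrite /hpart leqNgt ltn_ord.
rewrite [LHS](pihomog_partitionE lk); apply: eq_bigr => i _.
by rewrite /hpart leq_addr addKn.
Qed.

Lemma hpart_large d e p k : (msize p <= k)%N -> (e + k <= d)%N -> hpart d e p = 0.
Proof.
move=> lk led; rewrite /hpart; case: ifP => // _.
rewrite pihomogE big_seq_cond big1 // => b /andP[/msize_mdeg_lt lb /eqP eb].
by move: lb; rewrite eb; lia.
Qed.

Lemma hpart_diag d p : hpart d d p = (p@_0%MM)%:MP.
Proof.
rewrite /hpart leqnn subnn; apply/mpolyP => b.
rewrite mcoeffC; have [<-|nb] := eqVneq 0%MM b.
  rewrite mulr1; set q := pihomog _ _ _.
  rewrite [p in RHS](pihomog_partitionE (mf := mdeg) (leqnSn (msize p))).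
  rewrite (bigD1 ord0) //= mcoeffD -/q [X in _ + X]raddf_sum [X in _ + X]big1 ?addr0 // => k nk.
  apply: (dhomog_nemf_coeff (pihomogP _ _ _)); rewrite mf0 eq_sym.
  by apply: contra nk => /eqP e; apply/eqP/val_inj.
by rewrite mulr0; apply: (dhomog_nemf_coeff (pihomogP _ _ _)); rewrite mdeg_eq0 eq_sym.
Qed.

End Parts.

Section GradedSubmodules.
Variables (K : fieldType) (n m : nat) (a : 'I_m -> nat).
Notation S := {mpoly K[n]}.
Notation V := {ffun 'I_m -> S}.
Implicit Types (U : set V) (u v : V).

(** The [i]-th coordinate is shifted by [a i], which is the degree of the basis
    vector that it multiplies. *)
Definition vpart d u : V := [ffun i => hpart d (a i) (u i)].

Definition vhomog d u := forall i, homog_shift d (a i) (u i).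

Definition graded U := forall u d, U u -> U (vpart d u).

Lemma vpart_comb d (T : finType) (g : T -> V) (deg : T -> nat) c :
  (forall t, vhomog (deg t) (g t)) ->
  vpart d (vcomb g c) = vcomb g (fun t => hpart d (deg t) (c t)).
Proof.
move=> hg; apply/ffunP => i; rewrite ffunE !vcombE hpart_sum.
by apply: eq_bigr => t _; apply/hpartMl/hg.
Qed.

Lemma vpart_id d u : vhomog d u -> vpart d u = u.
Proof. by move=> hu; apply/ffunP => i; rewrite ffunE hpart_id. Qed.

Lemma vpart_homog d u : vhomog d (vpart d u).
Proof. by move=> i; rewrite ffunE; apply: hpart_homog. Qed.

Definition homgen N U (g : 'I_N -> V) (deg : 'I_N -> nat) :=
  generates U g /\ forall j, vhomog (deg j) (g j).

(** The homogeneous components of finitely many generators. *)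
Lemma exists_homgen U : submodule U -> graded U ->
  exists N (g : 'I_N -> V) deg, homgen U g deg.
Proof.
move=> sU gU; have [T [g [Ug gP]]] := submodule_fg sU.
pose D := (\max_i a i + \max_t \max_i msize (g t i))%N.
have gE t : g t = \sum_(d < D) vpart d (g t).
  apply/ffunP => i; rewrite sum_ffunE.
  have le1 : (msize (g t i) <= \max_t \max_i msize (g t i))%N.
    by rewrite (bigD1 t) //= leq_max (bigD1 i) //= leq_maxl.
  have lea : (a i <= \max_i a i)%N by rewrite (bigD1 i) //= leq_maxl.
  under eq_bigr do rewrite ffunE.
  have le2 : (a i + \max_t \max_i msize (g t i) <= D)%N by rewrite leq_add2r.
  rewrite {1}(hpart_partition (a i) le1).
  rewrite (big_ord_widen D (fun d => hpart d (a i) (g t i))) // [RHS](bigID (fun d : 'I_D => (d < a i + \max_t \max_i msize (g t i)))%N) /=.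
  rewrite [X in _ + X]big1 ?addr0 // => d.
  by rewrite -leqNgt => led; apply: (hpart_large le1).
pose T' := (T * 'I_D)%type; pose g' (x : T') := vpart x.2 (g x.1).
exists #|{: T'}|, (fun j => g' (enum_val j)), (fun j => nat_of_ord (enum_val j).2); split; last first.
  by move=> j; apply: vpart_homog.
split; first by move=> j; apply: gU.
move=> u /gP[c ->]; exists (fun j => c (enum_val j).1).
rewrite /vcomb -(big_enum_val (fun x : T' => vscale (c x.1) (g' x))) /=.
rewrite -(pair_bigA _ (fun t (d : 'I_D) => vscale (c t) (vpart d (g t)))) /=.
apply: eq_bigr => t _; rewrite {1}gE; apply/ffunP => i; rewrite ffunE !sum_ffunE mulr_sumr.
by apply: eq_bigr => d _; rewrite [in RHS]ffunE.
Qed.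

Definition min_homgen N U (g : 'I_N -> V) (deg : 'I_N -> nat) :=
  homgen U g deg /\ forall N' (g' : 'I_N' -> V) deg', homgen U g' deg' -> (N <= N')%N.

Lemma exists_min_homgen U : submodule U -> graded U ->
  exists N (g : 'I_N -> V) deg, min_homgen U g deg.
Proof.
move=> sU gU.
have ex : exists N, `[< exists (g : 'I_N -> V) deg, homgen U g deg >].
  by have [N [g [deg h]]] := exists_homgen sU gU; exists N; apply/asboolP; exists g, deg.
case: (ex_minnP ex) => N /asboolP[g [deg h]] minN; exists N, g, deg; split=> //.
by move=> N' g' deg' h'; apply: minN; apply/asboolP; exists g', deg'.
Qed.

(** A relation with an invertible coefficient, cut down to the degree of the
    generator concerned, would express it by the other generators. *)
Lemma min_homgen_rel N U (g : 'I_N -> V) deg c :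
  min_homgen U g deg -> vcomb g c = 0 -> forall j, (c j)@_0%MM = 0.
Proof.
case: N g deg c => [|N] g deg c [[[Ug gP] hg] minN] c0 j; first by case: j.
apply: contrapT => /eqP cj.
have := vpart_comb (deg j) c hg; rewrite c0 vpart_id; last first.
  by move=> i; rewrite ffunE /homog_shift; case: ifP => // _; apply: dhomog0.
set e := (fun t => hpart _ _ _) => /esym e0.
have ej : e j = ((c j)@_0%MM)%:MP by rewrite /e hpart_diag.
have gj i : g j i = - \sum_k (((c j)@_0%MM)^-1%:MP * e (lift j k)) * g (lift j k) i.
  have /ffunP/(_ i) := e0; rewrite vcombE ffunE (bigD1_ord j) //= ej => /eqP.
  rewrite addr_eq0 => /eqP e1.
  under eq_bigr do rewrite -mulrA.
  by rewrite -mulr_sumr -mulrN -e1 mulrA -mpolyCM mulVf // mul1r.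
suff /minN : homgen U (g \o lift j) (deg \o lift j) by rewrite ltnn.
split; last by move=> k; apply: hg.
split; first by move=> k; apply: Ug.
move=> u /gP[b ->].
exists (fun k => b (lift j k) - b j * (((c j)@_0%MM)^-1%:MP * e (lift j k))).
apply/ffunP => i; rewrite !vcombE (bigD1_ord j) //= gj mulrN addrC -mulNr.
under [RHS]eq_bigr do rewrite mulrBl.
rewrite sumrB mulNr; congr (_ - _); rewrite mulr_sumr.
by apply: eq_bigr => k _; rewrite !mulrA.
Qed.

End GradedSubmodules.

(** * Modules of projective dimension two *)

Section ImageModule.
Variables (R : nzRingType) (M N : lmodType R) (g : {linear M -> N}).

(** Images of linear maps as modules: projectivity only speaks of maps that are
    onto. *)
Definition in_image : pred N := fun y => `[< exists x, g x = y >].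

Lemma in_image_closed : submod_closed in_image.
Proof.
split; first by apply/asboolP; exists 0; rewrite linear0.
move=> a _ _ /asboolP[x <-] /asboolP[y <-].
by apply/asboolP; exists (a *: x + y); rewrite linearP.
Qed.

HB.instance Definition _ := GRing.isSubmodClosed.Build R N in_image in_image_closed.

Record image_module := ImageModule { image_val :> N; _ : in_image image_val }.
HB.instance Definition _ := [isSub for image_val].
HB.instance Definition _ := [Choice of image_module by <:].
HB.instance Definition _ := [SubChoice_isSubLmodule of image_module by <:].

Lemma image_elemP x : in_image (g x).
Proof. by apply/asboolP; exists x. Qed.

Definition onto_image x : image_module := ImageModule (image_elemP x).

Lemma onto_image_linear : linear onto_image.
Proof. by move=> a x y; apply: val_inj; rewrite /= linearP. Qed.

HB.instance Definition _ := GRing.isLinear.Build R M image_module _ onto_image onto_image_linear.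

Variables (P : lmodType R) (f : {linear P -> N}).
Hypothesis fg : forall p, exists x, g x = f p.

Lemma corestrP p : in_image (f p). Proof. exact/asboolP. Qed.

Definition corestr p : image_module := ImageModule (corestrP p).

Lemma corestr_linear : linear corestr.
Proof. by move=> a x y; apply: val_inj; rewrite /= linearP. Qed.

HB.instance Definition _ := GRing.isLinear.Build R P image_module _ corestr corestr_linear.

(** Projectivity applied to the corestriction of [g] to its image. *)
Lemma lift_image : projective P -> exists h : {linear P -> M}, forall p, g (h p) = f p.
Proof.
move=> projP.
have [|h hP] := projP M image_module onto_image corestr.
  by move=> [y Hy]; have [x e] := asboolP _ Hy; exists x; apply: val_inj.
by exists h => p; have /(congr1 val) := hP p.
Qed.

End ImageModule.

Section FreeModules.
Variables (R : comNzRingType) (k : nat) (M : lmodType R) (x : 'I_k -> M).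

Definition free_map (v : 'rV[R]_k) : M := \sum_i v 0 i *: x i.

Lemma free_map_linear : linear free_map.
Proof.
move=> a u v; rewrite /free_map scaler_sumr -big_split; apply: eq_bigr => i _.
by rewrite !mxE scalerDl scalerA.
Qed.

HB.instance Definition _ := GRing.isLinear.Build R 'rV[R]_k M _ free_map free_map_linear.

Lemma free_map_delta i : free_map (delta_mx 0 i) = x i.
Proof.
rewrite /free_map (bigD1 i) //= mxE !eqxx scale1r big1 ?addr0 // => j ji.
by rewrite mxE eqxx (negPf ji) scale0r.
Qed.

End FreeModules.

Lemma free_ext (R : comNzRingType) k (M : lmodType R) (f g : {linear 'rV[R]_k -> M}) :
  (forall i, f (delta_mx 0 i) = g (delta_mx 0 i)) -> f =1 g.
Proof.
move=> fg v; rewrite (row_sum_delta v) !linear_sum; apply: eq_bigr => i _.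
by rewrite !linearZ fg.
Qed.

Lemma free_projective (R : comNzRingType) k : projective ('rV[R]_k : lmodType R).
Proof.
move=> M N g f gsurj; have /choice[x xP] : forall i, exists y, g y = f (delta_mx 0 i).
  by move=> i; apply: gsurj.
exists (free_map x) => v; apply: (free_ext (f := g \o free_map x) (g := f)) => i /=.
by rewrite free_map_delta.
Qed.

Section Comparison.
Variables (R : comNzRingType) (M : lmodType R) (k m q : nat).
Variables (eta : {linear 'rV[R]_k -> M}) (d1 : {linear 'rV[R]_m -> 'rV[R]_k})
  (d2 : {linear 'rV[R]_q -> 'rV[R]_m}).
Hypothesis eta_surj : forall y, exists x, eta x = y.
Hypothesis exact0 : forall x, eta x = 0 <-> exists y, d1 y = x.
Hypothesis exact1 : forall x, d1 x = 0 <-> exists y, d2 y = x.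

(** Compare the free resolution with the projective one of length 2 by maps
    [phi] and [psi] in both directions. The composite [psi phi] is homotopic to
    the identity, and subtracting the homotopy makes [id - psi phi] take values in
    the kernel of [d2]. On that kernel [phi] vanishes, since it lands in the kernel
    of the last map of the projective resolution, which is injective. *)
Lemma kernel_retract : has_proj_resolution M 2 ->
  exists e : {linear 'rV[R]_q -> 'rV[R]_q},
    (forall x, d2 (e x) = 0) /\ forall x, d2 x = 0 -> e x = x.
Proof.
move=> [P [d [eps [projP eps_surj ex0 ex1 P0]]]].
have eta_d1 v : eta (d1 v) = 0 by apply/exact0; exists v.
have d1_d2 v : d1 (d2 v) = 0 by apply/exact1; exists v.
have eps_d v : eps (d 0%N v) = 0 by apply/ex0; exists v.
have dd i v : d i (d i.+1 v) = 0 by apply/ex1; exists v.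
have [phi0 phi0P] : exists h : {linear 'rV[R]_k -> P 0%N}, forall v, eps (h v) = eta v.
  exact/lift_image/free_projective.
have [phi1 phi1P] : exists h : {linear 'rV[R]_m -> P 1%N}, forall v, d 0%N (h v) = (phi0 \o d1) v.
  apply: lift_image; last exact: free_projective.
  by move=> v /=; apply/ex0; rewrite phi0P.
have [phi2 phi2P] : exists h : {linear 'rV[R]_q -> P 2%N}, forall v, d 1%N (h v) = (phi1 \o d2) v.
  apply: lift_image; last exact: free_projective.
  move=> v /=; apply/ex1.
  by rewrite phi1P /= d1_d2 linear0.
have [psi0 psi0P] : exists h : {linear P 0%N -> 'rV[R]_k}, forall v, eta (h v) = eps v.
  exact: lift_image.
have [psi1 psi1P] : exists h : {linear P 1%N -> 'rV[R]_m}, forall v, d1 (h v) = (psi0 \o d 0%N) v.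
  apply: lift_image => // v /=.
  by apply/exact0; rewrite psi0P.
have [psi2 psi2P] : exists h : {linear P 2%N -> 'rV[R]_q}, forall v, d2 (h v) = (psi1 \o d 1%N) v.
  apply: lift_image => // v /=.
  by apply/exact1; rewrite psi1P /= dd linear0.
have [h0 h0P] : exists h : {linear 'rV[R]_k -> 'rV[R]_m}, forall v, d1 (h v) = ((psi0 \o phi0) \- idfun) v.
  apply: lift_image; last exact: free_projective.
  move=> v /=; apply/exact0.
  by rewrite linearB /= psi0P phi0P subrr.
have [h1 h1P] : exists h : {linear 'rV[R]_m -> 'rV[R]_q},
    forall v, d2 (h v) = ((psi1 \o phi1) \- idfun \- (h0 \o d1)) v.
  apply: lift_image; last exact: free_projective.
  move=> v /=; apply/exact1.
  by rewrite !linearB /= psi1P /= phi1P h0P /= opprB addrC addrA subrK subrr.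
exists (idfun \- (psi2 \o phi2) \+ (h1 \o d2)); split => x /=.
  rewrite linearD linearB /= psi2P /= phi2P h1P /= d1_d2 linear0 subr0.
  by rewrite addrC addrA addrNK subrr.
move=> x0; rewrite x0 linear0 addr0.
have : d 1%N (phi2 x) = 0 by rewrite phi2P /= x0 linear0.
by case/ex1 => y <-; rewrite (P0 3%N isT y) !linear0 addr0.
Qed.

End Comparison.

Section FreeSyzygies.
Variables (K : fieldType) (n : nat).
Notation S := {mpoly K[n]}.

Definition syzygies m (f : 'I_m -> S) : set {ffun 'I_m -> S} :=
  [set u | \sum_i u i * f i = 0]%classic.

Lemma syzygies_submodule m (f : 'I_m -> S) : submodule (syzygies f).
Proof.
split; first by rewrite /syzygies /= big1 // => i _; rewrite ffunE mul0r.
move=> c u v u0 v0; rewrite /syzygies /=.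
under eq_bigr do rewrite !ffunE mulrDl -mulrA.
by rewrite big_split /= -mulr_sumr u0 v0 mulr0 addr0.
Qed.

(** A fixed vector of a matrix with entries in the irrelevant ideal has entries
    of arbitrarily high order. *)
Lemma fixed_vector_zero q (w : 'rV[S]_q) (A : 'I_q -> 'rV[S]_q) :
  (forall i j, (A i 0 j)@_0%MM = 0) -> w = \sum_i w 0 i *: A i -> w = 0.
Proof.
move=> A0 wE.
suff ord k j b : (mdeg b < k)%N -> (w 0 j)@_b = 0.
  by apply/rowP => j; apply/mpolyP => b; rewrite mxE mcoeff0 (ord _ _ _ (ltnSn _)).
elim: k j b => // k IH j b ltb.
rewrite wE summxE raddf_sum big1 // => i _; rewrite mxE /= mcoeffM big1 // => -[b1 b2] /= /eqP bE.
have [b20|b2n0] := eqVneq (b2 : 'X_{1..n}) 0%MM; first by rewrite b20 A0 mulr0.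
rewrite IH ?mul0r // -ltnS (leq_trans _ ltb) // ltnS.
have bD : mdeg b = (mdeg b1 + mdeg b2)%N by rewrite [in LHS]bE mdegD.
apply: (@leq_trans (mdeg b1 + mdeg b2)); last by rewrite -bD.
by rewrite -[ltnLHS]addn0 ltn_add2l lt0n mdeg_eq0.
Qed.

Section Resolution.
Variables (I : idealr S) (m q : nat) (f : 'I_m -> S) (z : 'I_q -> {ffun 'I_m -> S}).
Hypothesis genI : forall p, p \in I <-> span_ideal f p.
Hypothesis genZ : generates (syzygies f) z.
Hypothesis minZ : forall c, vcomb z c = 0 -> forall j, (c j)@_0%MM = 0.

Let eta := free_map (fun _ : 'I_1 => 1 : {ideal_quot I}) : {linear 'rV[S]_1 -> {ideal_quot I}}.
Let d1 := free_map (fun i => (f i)%:M : 'rV[S]_1) : {linear 'rV[S]_m -> 'rV[S]_1}.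
Let d2 := free_map (fun j => \row_i z j i) : {linear 'rV[S]_q -> 'rV[S]_m}.

Let etaE v : eta v = \pi_({ideal_quot I})%qT (v 0 0).
Proof. by rewrite /eta /= /free_map big_ord1 /GRing.scale /= /quot_scale mulr1. Qed.

Let d1E v : d1 v 0 0 = \sum_i v 0 i * f i.
Proof. by rewrite /d1 /= /free_map summxE; apply: eq_bigr => i _; rewrite !mxE mulr1n. Qed.

Let d2E v i : d2 v 0 i = vcomb z (v 0) i.
Proof. by rewrite /d2 /= /free_map summxE vcombE; apply: eq_bigr => j _; rewrite !mxE. Qed.

Let d2_eq0 v : d2 v = 0 -> vcomb z (v 0) = 0.
Proof. by move=> v0; apply/ffunP => i; rewrite -d2E v0 mxE ffunE. Qed.

Let eta_surj y : exists x, eta x = y.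
Proof. by exists (repr y)%:M; rewrite etaE mxE mulr1n reprK. Qed.

Let exact0 x : eta x = 0 <-> exists y, d1 y = x.
Proof.
rewrite etaE; have -> : \pi_({ideal_quot I})%qT (x 0 0) = 0 <-> x 0 0 \in I.
  by rewrite -[x 0 0 in X in _ <-> X]subr0 Quotient.idealrBE rmorph0; split=> [->|/eqP].
split=> [/genI[c xc]|[y <-]]; last by apply/genI; exists (y 0); rewrite d1E.
exists (\row_i c i); apply/rowP => i; rewrite ord1 d1E xc.
by apply: eq_bigr => j _; rewrite mxE.
Qed.

Let exact1 x : d1 x = 0 <-> exists y, d2 y = x.
Proof.
have -> : d1 x = 0 <-> syzygies f [ffun i => x 0 i].
  split=> [x0|]; rewrite /syzygies /=; under eq_bigr do rewrite ffunE.
    by rewrite -d1E x0 mxE.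
  by rewrite -d1E => x0; apply/rowP => i; rewrite ord1 x0 mxE.
case: genZ => Uz zP; split=> [/zP[c xc]|[y <-]].
  exists (\row_j c j); apply/rowP => i; rewrite d2E.
  have /ffunP/(_ i) := xc; rewrite ffunE => ->; rewrite !vcombE.
  by apply: eq_bigr => j _; rewrite mxE.
rewrite /syzygies /=; under eq_bigr do rewrite ffunE d2E vcombE mulr_suml.
rewrite exchange_big big1 // => j _ /=.
by under eq_bigr do rewrite -mulrA; rewrite -mulr_sumr (Uz j) mulr0.
Qed.

(** By minimality the kernel of [d2] consists of vectors with entries in the
    irrelevant ideal, and [kernel_retract] writes each of them as a combination
    of such vectors with its own entries as coefficients. *)
Lemma syzygies_free : has_proj_resolution ({ideal_quot I} : lmodType S) 2 ->
  forall c, vcomb z c = 0 -> forall j, c j = 0.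
Proof.
move=> res c c0 j.
have [e [de ed]] := kernel_retract eta_surj exact0 exact1 res.
pose w : 'rV[S]_q := \row_j c j.
suff /rowP/(_ j) : w = 0 by rewrite !mxE.
apply: (@fixed_vector_zero _ w (fun i => e (delta_mx 0 i))).
  by move=> i k; apply: (minZ (c := e (delta_mx 0 i) 0)); apply/d2_eq0/de.
rewrite -[LHS]ed; last first.
  have w0 : vcomb z (w 0) = 0 by rewrite -c0; apply: eq_bigr => t _; rewrite mxE.
  by apply/rowP => i; rewrite d2E w0 ffunE mxE.
rewrite {1}[w]row_sum_delta linear_sum; apply: eq_bigr => i _.
by rewrite linearZ.
Qed.

End Resolution.
End FreeSyzygies.

(** * Minimal homogeneous generators of an ideal *)

Section MinimalGenerators.
Variables (K : fieldType) (n : nat).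
Notation S := {mpoly K[n]}.
Variable I : idealr S.

Definition hom_gens N (f : 'I_N -> S) (a : 'I_N -> nat) :=
  [/\ forall i, f i \in I, forall i, f i \is (a i).-homog
    & forall p, p \in I -> span_ideal f p].

Definition min_gens N (f : 'I_N -> S) (a : 'I_N -> nat) :=
  hom_gens f a /\ forall N' (f' : 'I_N' -> S) a', hom_gens f' a' -> (N <= N')%N.

(** An ideal is a submodule of the free module of rank one. *)
Definition ideal_submodule : set {ffun 'I_1 -> S} := [set u | u ord0 \in I]%classic.

Lemma ideal_submoduleP : submodule ideal_submodule.
Proof.
split; first by rewrite /ideal_submodule /= ffunE idealr0.
by move=> c u v uI vI; rewrite /ideal_submodule /= !ffunE rpredD ?idealMr.
Qed.

Lemma hom_gens_homgen N (f : 'I_N -> S) a : hom_gens f a ->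
  homgen (fun=> 0%N) ideal_submodule (fun i => [ffun=> f i]) a.
Proof.
move=> [fI fa fgen]; split; last first.
  by move=> i j; rewrite /homog_shift ffunE leq0n subn0.
split=> [i|u /fgen[c uc]]; first by rewrite /ideal_submodule /= ffunE.
exists c; apply/ffunP => i; rewrite ord1 uc vcombE.
by apply: eq_bigr => j _; rewrite ffunE.
Qed.

Lemma homgen_hom_gens N (g : 'I_N -> {ffun 'I_1 -> S}) a :
  homgen (fun=> 0%N) ideal_submodule g a -> hom_gens (fun i => g i ord0) a.
Proof.
move=> [[gI ggen] ga]; split=> [i|i|p pI]; first exact: gI.
  by have := ga i ord0; rewrite /homog_shift leq0n subn0.
have [|c pc] := ggen [ffun=> p]; first by rewrite /ideal_submodule /= ffunE.
by exists c; have /ffunP/(_ ord0) := pc; rewrite ffunE vcombE.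
Qed.

Lemma exists_min_gens : homogeneous_ideal I -> exists N (f : 'I_N -> S) a, min_gens f a.
Proof.
move=> hI; have [|N [g [a [hg ming]]]] := @exists_min_homgen _ n 1 (fun=> 0%N) _ ideal_submoduleP.
  move=> u d uI; rewrite /ideal_submodule /= ffunE /hpart leq0n.
  exact: hI.
exists N, (fun i => g i ord0), a; split; first exact: homgen_hom_gens.
by move=> N' f' a' /hom_gens_homgen/ming.
Qed.

Lemma min_gens_rel N (f : 'I_N -> S) a c : min_gens f a ->
  \sum_i c i * f i = 0 -> forall i, (c i)@_0%MM = 0.
Proof.
move=> [hf minf] c0; apply: (@min_homgen_rel _ _ _ (fun=> 0%N) N ideal_submodule (fun i => [ffun=> f i]) a).
  split; first exact: hom_gens_homgen.
  by move=> N' g' a' /homgen_hom_gens/minf.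
by apply/ffunP => i; rewrite vcombE ffunE -[RHS]c0; apply: eq_bigr => j _; rewrite ffunE.
Qed.

End MinimalGenerators.

Section StandardBasis.
Variables (K : fieldType) (n : nat).
Notation S := {mpoly K[n]}.
Variables (I : idealr S) (N : nat) (f : 'I_N -> S) (a : 'I_N -> nat).
Hypothesis minf : min_gens I f a.

Lemma min_gens_neq0 i : f i != 0.
Proof.
apply/eqP => fi0; have rel : \sum_j (j == i)%:R * f j = 0.
  by rewrite (bigD1 i) //= fi0 mulr0 add0r big1 // => j /negPf ->; rewrite mul0r.
have := min_gens_rel minf rel i; rewrite eqxx mcoeff1 eqxx => /eqP.
by rewrite oner_eq0.
Qed.

Lemma min_gens_homogE i d : (f i \is d.-homog) = (a i == d).
Proof.
have [[_ fa _] _] := minf.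
apply/idP/eqP => [fd|<-]; last exact: fa.
exact: dhomog_uniq (min_gens_neq0 i) (fa i) fd.
Qed.

Lemma min_gens_inj : injective f.
Proof.
move=> i j fij; apply/eqP/contraT => nij.
have sumE k : \sum_l (l == k)%:R * f l = f k.
  by rewrite (bigD1 k) //= eqxx mul1r big1 ?addr0 // => l /negPf ->; rewrite mul0r.
have rel : \sum_k ((k == i)%:R - (k == j)%:R) * f k = 0.
  by under eq_bigr do rewrite mulrBl; rewrite sumrB !sumE fij subrr.
have := min_gens_rel minf rel i.
by rewrite eqxx (negPf nij) subr0 mcoeff1 eqxx => /eqP; rewrite oner_eq0.
Qed.

Lemma sumsD (R : comNzRingType) (A : set R) p q : sums A p -> sums A q -> sums A (p + q).
Proof.
move=> [s sA ->] [t tA ->]; exists (s ++ t); last by rewrite big_cat.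
by move=> x; rewrite mem_cat => /orP[/sA|/tA].
Qed.

Lemma sums0 (R : comNzRingType) (A : set R) : sums A 0.
Proof. by exists [::] => //; rewrite big_nil. Qed.

Lemma sums1 (R : comNzRingType) (A : set R) x : A x -> sums A x.
Proof. by move=> Ax; exists [:: x]; [move=> y; rewrite inE => /eqP ->|rewrite big_seq1]. Qed.

Lemma sums_ind (R : comNzRingType) (A : set R) (P : R -> Prop) :
  P 0 -> (forall x y, P x -> P y -> P (x + y)) -> (forall x, A x -> P x) ->
  forall p, sums A p -> P p.
Proof.
move=> P0 PD PA p [s sA ->]; rewrite big_seq; apply: (big_ind P) => // x xs.
exact/PA/sA.
Qed.

Lemma lower_forms_sub d : subspace (lower_forms I d).
Proof.
case: d => [|d] /=; first exact: zero_subspace.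
split; first exact: sums0.
move=> c x y Wx Wy; apply: sumsD => //.
move: x Wx; apply: sums_ind => [|x1 x2 h1 h2|x [g [gI gd] [h hd] <-]].
- by rewrite scaler0; apply: sums0.
- by rewrite scalerDr; apply: sumsD.
- apply: sums1; exists (c *: g); last by exists h => //; rewrite -scalerAl.
  split; last exact: dhomogZ.
  by rewrite /= -mul_mpolyC idealMr.
Qed.

(** The coefficients come from the linear factors in [I_(d-1) S_1]. *)
Lemma lower_forms_coef d w : lower_forms I d w ->
  exists2 e : 'I_N -> S, forall j, (e j)@_0%MM = 0 & w = \sum_j e j * f j.
Proof.
have [[_ _ fgen] _] := minf.
case: d => [->|d /=].
  by exists (fun=> 0) => [j|]; rewrite ?mcoeff0 // big1 // => j _; rewrite mul0r.
move: w; apply: sums_ind => [|x1 x2 [e1 e10 ->] [e2 e20 ->]|x [g [gI gd] [h hd] <-]].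
- by exists (fun=> 0) => [j|]; rewrite ?mcoeff0 // big1 // => j _; rewrite mul0r.
- exists (fun j => e1 j + e2 j) => [j|]; first by rewrite mcoeffD e10 e20 addr0.
  by rewrite -big_split; apply: eq_bigr => j _; rewrite mulrDl.
- have [c ->] := fgen _ gI.
  exists (fun j => h * c j) => [j|]; last first.
    by rewrite mulr_suml; apply: eq_bigr => j _; rewrite mulrC mulrA.
  by rewrite rmorphM /= (dhomog_nemf_coeff hd) ?mul0r // mf0.
Qed.

Lemma lower_formsM d k e p : p \in I -> p \is k.-homog -> (k < d)%N ->
  e \is (d - k).-homog -> lower_forms I d (e * p).
Proof.
move=> pI pk ltkd ehom.
rewrite [e]mpolyE mulr_suml big_seq.
apply: (subspace_sum (lower_forms_sub d)) => b be.
have bd : mdeg b = (d - k)%N by apply: (dhomog_mf ehom).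
have [i bi] : exists i, (U_(i) <= b)%MM.
  have : mdeg b != 0%N by rewrite bd; lia.
  rewrite mdegE; apply: contraNP => nex; apply/eqP/big1 => i _; apply/eqP.
  by apply: contraT => bi; case: nex; exists i; rewrite lep1mP.
rewrite -scalerAl; apply: subspaceZ; first exact: lower_forms_sub.
case: d ltkd bd {ehom} => // d ltkd bd /=; apply: sums1.
exists ('X_[b - U_(i)] * p); last exists 'X_i.
- split; first by rewrite /= idealMr.
  rewrite /forms /= (_ : d = (mdeg (b - U_(i))%MM + k)%N).
    by apply: dhomogM => //; rewrite dhomogX.
  have := mdegD (b - U_(i)) U_(i); rewrite submK // mdeg1 bd; lia.
- by rewrite /forms /= dhomogX; apply/eqP; apply: mdeg1.
- by rewrite mulrC mulrA -mpolyXD addmC submK.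
Qed.

Lemma map_val_enum (T : finType) (P : pred T) :
  [seq val t | t <- enum {: {x : T | P x}}] = enum P.
Proof.
rewrite enumT unlock /= pmap_filter; last exact: insubK.
by apply: eq_filter => x; apply: isSome_insub.
Qed.

(** In degree [d], the coefficient of a generator of degree less than [d] has
    positive degree, so that it contributes to [I_(d-1) S_1]; that of a
    generator of degree [d] is a scalar, and none of these scalars can be nonzero
    in a relation modulo [I_(d-1) S_1]. *)
Lemma min_gens_graded_basis d :
  fbasis (forms_in I d) (lower_forms I d) (fun t : {i | a i == d} => f (val t)).
Proof.
have [[fI fa fgen] _] := minf; split.
- by case=> i /= /eqP <-; split; [exact: fI|exact: fa].
- move=> p [pI pd]; have [e pe] := fgen _ pI.
  exists (fun t => (e (val t))@_0%MM).
  have -> : lincomb (fun t : {i | a i == d} => f (val t)) (fun t => (e (val t))@_0%MM)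
          = \sum_(j | a j == d) hpart d (a j) (e j) * f j.
    rewrite /lincomb (reindex_omap (val : {i | a i == d} -> _) insub) /=; last first.
      by move=> i ai; rewrite insubT.
    apply: eq_big => [t|[i /= /eqP <-] _]; last by rewrite hpart_diag mul_mpolyC.
    by case: t => i ai /=; rewrite ai insubT eqxx.
  have -> : p = \sum_j hpart d (a j) (e j) * f j.
    rewrite -[LHS](@hpart_id _ _ d 0); last by rewrite /homog_shift leq0n subn0.
    rewrite {1}pe hpart_sum; apply: eq_bigr => j _; apply: hpartMl.
    by rewrite /homog_shift leq0n subn0; apply: fa.
  rewrite (bigID (fun j => a j == d)) /= addrAC subrr add0r.
  apply: (subspace_sum (lower_forms_sub d)) => j nj.
  rewrite /hpart; case: ifP => lejd; last first.
    by rewrite mul0r; apply: subspace0 (lower_forms_sub d).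
  apply: (lower_formsM (k := a j)) => //; first by rewrite ltn_neqAle nj.
  exact: pihomogP.
- move=> c /lower_forms_coef[e e0 eE] [i /= ai].
  have rel : \sum_j ((if insub j is Some t then c t else 0)%:MP - e j) * f j = 0.
    under eq_bigr do rewrite mulrBl; rewrite sumrB -eE; apply/eqP; rewrite subr_eq0; apply/eqP.
    rewrite (bigID (fun j => a j == d)) /= [X in _ + X]big1 ?addr0; last first.
      by move=> j /negPf nj; rewrite insubF // mpolyC0 mul0r.
    rewrite /lincomb [LHS](reindex_omap (val : {i | a i == d} -> _) insub) /=; last first.
      by move=> j aj; rewrite insubT.
    apply: eq_big => [[j aj]|[j /= aj] _] /=; first by rewrite aj insubT eqxx.
    by rewrite insubT mul_mpolyC.
  have := min_gens_rel minf rel i; rewrite mcoeffB mcoeffC eqxx mulr1 e0 subr0.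
  by rewrite insubT.
Qed.

Definition gens_seq := [seq f i | i <- enum 'I_N].

Lemma mem_gens_seq p : (p \in gens_seq) <-> exists i, p = f i.
Proof.
split=> [/mapP[i _ ->]|[i ->]]; first by exists i.
by apply: map_f; rewrite mem_enum.
Qed.

Lemma ideal_gen_span (A : set S) p : (forall x, A x -> exists i, x = f i) ->
  ideal_gen A p -> exists2 c : 'I_N -> S, p = \sum_i c i * f i & forall i, c i != 0 -> A (f i).
Proof.
move=> Af; move: p; apply: sums_ind => [|x y [c -> cA] [e -> eA]|_ [b _ [x Ax <-]]].
- exists (fun=> 0) => [|i]; last by rewrite eqxx.
  by rewrite big1 // => i _; rewrite mul0r.
- exists (fun i => c i + e i) => [|i].
    by rewrite -big_split; apply: eq_bigr => i _; rewrite mulrDl.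
  have [->|/cA //] := eqVneq (c i) 0; rewrite add0r; exact: eA.
- have [i xi] := Af _ Ax; exists (fun j => if j == i then b else 0) => [|j].
    rewrite (bigD1 i) //= eqxx big1 ?addr0 ?xi // => j /negPf ->.
    by rewrite mul0r.
  by have [-> _|_] := eqVneq j i; rewrite -?xi ?eqxx.
Qed.

Lemma min_gens_standard_basis : standard_basis I gens_seq.
Proof.
have [[fI fa fgen] _] := minf; split.
- by rewrite map_inj_uniq ?enum_uniq //; apply: min_gens_inj.
- by move=> p /mem_gens_seq[i ->]; exists (a i).
- apply/seteqP; split => p /=.
    move: p; apply: sums_ind => [|x y|_ [b _ [x /= /mem_gens_seq[i ->] <-]]].
    + exact: idealr0.
    + exact: rpredD.
    + exact: idealMr.
  move=> /fgen[c ->]; apply: big_ind; [exact: sums0|exact: sumsD|].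
  move=> i _; apply: sums1; exists (c i) => //; exists (f i) => //.
  by apply/mem_gens_seq; exists i.
- move=> d; have := fbasis_basis_mod (lower_forms_sub d) (min_gens_graded_basis d).
  congr (basis_mod _ _ _); rewrite (map_comp f val) map_val_enum filter_map; congr map.
  rewrite [in RHS]enumT; apply: eq_filter => i /=.
  by rewrite min_gens_homogE.
Qed.

Lemma irrelevant_powX t (b : 'X_{1..n}) : mdeg b = t -> ideal_pow (@irrelevant_ideal K n) t 'X_[b].
Proof.
elim: t b => [|t IH] b bt //=.
have [i bi] : exists i, (U_(i) <= b)%MM.
  have : mdeg b != 0%N by rewrite bt.
  rewrite mdegE; apply: contraNP => nex; apply/eqP/big1 => i _; apply/eqP.
  by apply: contraT => bi; case: nex; exists i; rewrite lep1mP.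
apply: sums1; exists 'X_i.
  by apply: sums1; exists 1 => //; exists 'X_i; rewrite ?mul1r //; exists i.
exists 'X_[b - U_(i)]; last by rewrite -mpolyXD addmC submK.
by apply: IH; have := mdegD (b - U_(i)) U_(i); rewrite submK // mdeg1 bt; lia.
Qed.

Lemma inessentialP i : inessential gens_seq (f i) -> exists t, forall b, mdeg b = t ->
  exists2 c : 'I_N -> S, f i * 'X_[b] = \sum_j c j * f j & c i = 0.
Proof.
move=> [t tP]; exists t => b /irrelevant_powX/tP/ideal_gen_span[|c bc cA].
  by move=> x [/mem_gens_seq].
exists c => //; apply/eqP; apply: contraT => /cA[_ []].
by [].
Qed.

(** Evaluate at [x] a multiple of [f i] by a power of the variable [l]: it does
    not vanish, whereas the other generators do. *)
Lemma essential_of_point i (x : 'I_n -> K) l :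
  (forall k, (f k).@[x] = (k == i)%:R) -> x l != 0 -> essential gens_seq (f i).
Proof.
move=> fx xl /inessentialP[t /(_ (U_(l) *+ t)%MM)[|c]].
  by rewrite mdegMn mdeg1 mul1n.
move=> /(congr1 (meval x)); rewrite mevalM fx eqxx mul1r raddf_sum /= => e ci.
have : ('X_[U_(l) *+ t]).@[x] = 0.
  rewrite e big1 // => k _; rewrite mevalM fx.
  by have [->|_] := eqVneq k i; rewrite ?mulr0 // ci meval0 mul0r.
by apply/eqP; rewrite -mpolyXn rmorphXn /= mevalXU expf_neq0.
Qed.

End StandardBasis.

(** * Separating the generators of least degree by points *)

Section Nonvanishing.

Lemma digits_inj D n (b c : 'I_n -> nat) :
  (forall i, b i < D)%N -> (forall i, c i < D)%N ->
  (\sum_i b i * D ^ i = \sum_i c i * D ^ i)%N -> b =1 c.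
Proof.
elim: n b c => [|n IH] b c bD cD; first by move=> _ [].
have D0 : (0 < D)%N by apply: leq_ltn_trans (bD ord0).
have shift (e : 'I_n.+1 -> nat) : (\sum_i e i * D ^ i)%N
    = ((\sum_i e (lift ord0 i) * D ^ i) * D + e ord0)%N.
  rewrite big_ord_recl /= muln1 big_distrl /= addnC; congr addn.
  by apply: eq_bigr => i _; rewrite /bump expnSr mulnA.
rewrite !shift => e.
have e0 : b ord0 = c ord0.
  by have /(congr1 (modn^~ D)) := e; rewrite !modnMDl !modn_small.
have /IH e1 : (\sum_i b (lift ord0 i) * D ^ i = \sum_i c (lift ord0 i) * D ^ i)%N.
  by apply/eqP; rewrite -(eqn_pmul2r D0) -(eqn_add2r (b ord0)) e e0.
by move=> i; case: (unliftP ord0 i) => [j|] ->; [apply: e1|].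
Qed.

(** If [p] is not constant, it takes the value 1. *)
Lemma poly_nonroot (K : closedFieldType) (p : {poly K}) : p != 0 -> exists x, p.[x] != 0.
Proof.
move=> p0; have [sz1|sz1] := eqVneq (size p) 1%N.
  move/eqP/size_poly1P: sz1 => [c c0 ->]; exists 0; by rewrite hornerC.
have [|x] := closed_rootP (p - 1) _; last first.
  by rewrite /root hornerD hornerN hornerC subr_eq0 => /eqP px; exists x; rewrite px oner_eq0.
rewrite size_addl //; rewrite size_opp size_poly1 ltnNge; apply: contra sz1.
by case: (size p) (size_poly_eq0 p) => [|[|]]//; rewrite (negPf p0).
Qed.

(** Kronecker substitution [X_i := y ^ (D ^ i)], with [D] above all exponents,
    keeps the monomials apart. *)
Lemma mpoly_nonroot (K : closedFieldType) n (p : {mpoly K[n]}) :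
  p != 0 -> exists x : 'I_n -> K, p.@[x] != 0.
Proof.
move=> p0; pose D := msize p; pose e (b : 'X_{1..n}) := (\sum_i b i * D ^ i)%N.
pose q := \sum_(b <- msupp p) p@_b *: 'X^(e b).
have bD b : b \in msupp p -> forall i, (b i < D)%N.
  move=> /msize_mdeg_lt; rewrite mdegE => lb i; apply: leq_ltn_trans lb.
  by rewrite (bigD1 i) //= leq_addr.
have [|y qy] := @poly_nonroot K q.
  have /mlead_supp lp := p0; apply/eqP => /(congr1 (fun r : {poly K} => r`_(e (mlead p)))).
  rewrite coef0 coef_sum (bigD1_seq (mlead p)) ?msupp_uniq //= coefZ coefXn eqxx mulr1 big_seq_cond.
  rewrite big1 ?addr0 => [/eqP|b /andP[bp nb]]; first by rewrite mleadc_eq0 (negPf p0).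
  rewrite coefZ coefXn; case: eqP => [eb|]; last by rewrite mulr0.
  by case/eqP: nb; apply/mnmP => i; apply/esym; apply: digits_inj eb i; apply: bD.
exists (fun i => y ^+ (D ^ i)); rewrite mevalE.
move: qy; rewrite horner_sum; congr (_ != _); apply: eq_bigr => b _.
rewrite hornerZ hornerXn -prodrXr; congr (_ * _); apply: eq_bigr => i _.
by rewrite mulnC exprM.
Qed.

End Nonvanishing.

Section Points.
Variables (K : closedFieldType) (n : nat).
Notation S := {mpoly K[n]}.
Variables (I : idealr S).

(** The new family still generates [I] and has as many elements, so it is
    minimal again. *)
Lemma min_gens_elementary N (f : 'I_N -> S) a i (v : K) (h : 'I_N -> S) :
  min_gens I f a -> v != 0 -> (forall k, k != i -> h k * f i \is (a k).-homog) ->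
  min_gens I (fun k => if k == i then v *: f i else f k - h k * f i) a.
Proof.
move=> [[fI fa fgen] minf] v0 ha; split=> //; split.
- move=> k; case: ifP => _; first by rewrite -mul_mpolyC idealMr.
  by rewrite rpredB // idealMr.
- move=> k; case: eqP => [->|/eqP ki]; first exact: dhomogZ.
  by apply: rpredB => //; apply: ha.
move=> p /fgen[c ->].
exists (fun k => if k == i then v^-1 *: (c i + \sum_(l | l != i) c l * h l) else c k).
rewrite [RHS](bigD1 i) //= eqxx -scalerAl -scalerAr scalerA mulVf // scale1r.
rewrite [LHS](bigD1 i) //= mulrDl -addrA; congr (_ + _).
rewrite mulr_suml -big_split /=; apply: eq_bigr => k /negPf ->.
by rewrite mulrBr mulrA addrC subrK.
Qed.

(** The generators of degree [a0] are treated one after the other. For [f i],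
    choose a point [x] where it does not vanish, scale it to take the value 1 there,
    and make the others vanish at [x] by subtracting multiples of [f i] of the
    right degree. The points chosen before are zeros of [f i], so the values
    there do not change. *)
Lemma min_gens_points N (f : 'I_N -> S) a (a0 : nat) :
  min_gens I f a -> (0 < a0)%N -> (forall i, a0 <= a i)%N ->
  exists2 f' : 'I_N -> S, min_gens I f' a &
    forall i, a i = a0 -> exists2 x : 'I_n -> K,
      forall k, (f' k).@[x] = (k == i)%:R & exists l, x l != 0.
Proof.
move=> minf a0_gt0 a0P.
suff /(_ (enum 'I_N))[f' mf' fP] : forall s : seq 'I_N,
    exists2 f' : 'I_N -> S, min_gens I f' a &
    forall i, i \in s -> a i = a0 -> exists2 x : 'I_n -> K,
      forall k, (f' k).@[x] = (k == i)%:R & exists l, x l != 0.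
  by exists f' => // i; apply: fP; rewrite mem_enum.
elim=> [|i s [f' mf' fP]]; first by exists f.
have [ais|] := boolP ((a i == a0) && (i \notin s)); last first.
  rewrite negb_and negbK => ais; exists f' => // j; rewrite inE => /orP[/eqP ->|/fP //].
  by case/orP: ais => [/eqP //|/fP].
have /andP[/eqP ai is_] := ais.
have [x fx] := mpoly_nonroot (min_gens_neq0 mf' i).
have [l xl] : exists l, x l != 0.
  apply: contrapT => nx; case/eqP: fx.
  have x0 l : x l = 0 by apply/eqP; apply: contraT => xl; case: nx; exists l.
  rewrite mevalE big_seq big1 // => b bf; have [[_ fa _] _] := mf'.
  have : mdeg b != 0%N by rewrite (dhomog_mf (fa i) bf) ai -lt0n.
  rewrite mdegE sum_nat_eq0 negb_forall => /existsP[l /= bl].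
  by rewrite (bigD1 l) //= x0 expr0n (negPf bl) mul0r mulr0.
pose v := (f' i).@[x].
(* A form of the degree that is missing, with value 1 at [x]. *)
pose g k : S := ((x l)^-1 *: 'X_l) ^+ (a k - a0).
have gx k : (g k).@[x] = 1 by rewrite rmorphXn /= mevalZ mevalXU mulVf // expr1n.
pose h k := ((f' k).@[x] / v) *: g k.
exists (fun k => if k == i then v^-1 *: f' i else f' k - h k * f' i).
  apply: min_gens_elementary; rewrite ?invr_eq0 // => k _.
  have [[_ fa _] _] := mf'.
  rewrite -scalerAl; apply: dhomogZ.
  rewrite (_ : a k = (1 * (a k - a0) + a i)%N); last by rewrite mul1n ai subnK.
  by apply: dhomogM => //; apply: dhomogMn; apply: dhomogZ; rewrite dhomogX; apply/eqP/mdeg1.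
move=> j; rewrite inE; have [-> _ _|ji /= js aj] := eqVneq j i.
  exists x; last by exists l.
  move=> k; case: ifP => _; first by rewrite mevalZ mulVf.
  by rewrite mevalB mevalM mevalZ gx mulr1 divfK // subrr.
have [y fy yl] := fP j js aj; exists y => // k.
have fiy : (f' i).@[y] = 0 by rewrite fy eq_sym (negPf ji).
case: eqP => [->|_]; last by rewrite mevalB mevalM fiy mulr0 subr0 fy.
by rewrite mevalZ fiy mulr0 eq_sym (negPf ji).
Qed.

End Points.

(** * Dimension through growth of filtered quotients *)

Section Growth.
Variables (K : fieldType) (n : nat).
Notation S := {mpoly K[n]}.
Implicit Types (J P Q : set S) (p q f g : S).

Definition deg_lt t : set S := [set p | msize p <= t]%N%classic.

(** The Hilbert function of [S/J] is at least a multiple of [t ^ r]: for an ideal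
    this means that [S/J] has dimension at least [r]. It is only required for
    arbitrarily large [t], since this form passes to one of two ideals when it
    holds for a sum of two Hilbert functions. *)
Definition growth J r := exists C, forall N, exists2 t, (N <= t)%N &
  exists k (b : 'I_k -> S), [/\ forall i, deg_lt t (b i), indep J b & (t ^ r <= C * k)%N].

Lemma deg_ltD t p q : deg_lt t p -> deg_lt t q -> deg_lt t (p + q).
Proof.
by move=> pt qt; apply: leq_trans (msizeD_le _ _) _; rewrite geq_max pt.
Qed.

Lemma deg_ltM_pred t s p q : deg_lt t p -> deg_lt s q -> deg_lt (t + s).-1 (p * q).
Proof.
have [->|p0] := eqVneq p 0; first by rewrite mul0r /deg_lt /= msize0.
have [->|q0] := eqVneq q 0; first by rewrite mulr0 /deg_lt /= msize0.
by rewrite /deg_lt /= msizeM // => pt qs; rewrite -!subn1 leq_sub2r ?leq_add.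
Qed.

Lemma deg_ltM t s p q : deg_lt t p -> deg_lt s q -> deg_lt (t + s) (p * q).
Proof. by move=> pt qs; apply: leq_trans (deg_ltM_pred pt qs) (leq_pred _). Qed.

Lemma deg_ltW t s p : (t <= s)%N -> deg_lt t p -> deg_lt s p.
Proof. by move=> ts pt; apply: leq_trans ts. Qed.

Lemma deg_lt_sub t : subspace (deg_lt t).
Proof.
split; first by rewrite /deg_lt /= msize0.
move=> a x y xt yt; apply: deg_ltD => //.
exact: leq_trans (msizeZ_le _ _) xt.
Qed.

Lemma spanmod_monomials J t p : subspace J -> deg_lt t p ->
  spanmod J (fun e : {ffun 'I_n -> 'I_t} => 'X_[[multinom (e i : nat) | i < n]]) p.
Proof.
move=> sJ pt; rewrite [p]mpolyE big_seq.
apply: (subspace_sum (spanmod_sub sJ _)) => b /msize_mdeg_lt bp.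
have lt_b i : (b i < t)%N.
  apply: leq_trans pt; apply: leq_ltn_trans bp.
  by rewrite mdegE (bigD1 i) //= leq_addr.
apply: subspaceZ; first exact: spanmod_sub.
have -> : b = [multinom ([ffun i => Ordinal (lt_b i)] i : nat) | i < n].
  by apply/mnmP => i; rewrite mnmE ffunE.
exact: (spanmod_mem sJ (fun e : {ffun 'I_n -> 'I_t} => 'X_[[multinom (e i : nat) | i < n]])).
Qed.

Lemma indep_deg_lt J t (T : finType) (b : T -> S) :
  subspace J -> (forall i, deg_lt t (b i)) -> indep J b -> (#|T| <= t ^ n)%N.
Proof.
move=> sJ bt ib; have := indep_leq sJ ib (fun i => spanmod_monomials sJ (bt i)).
by rewrite card_ffun !card_ord.
Qed.

Lemma exists_deg_lt_basis J t : subspace J -> exists k (b : 'I_k -> S), fbasis (deg_lt t) J b.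
Proof.
move=> sJ; apply: (exists_fbasis sJ (N := t ^ n)) => k b bt ib.
by rewrite -[k]card_ord; apply: indep_deg_lt bt ib.
Qed.

Lemma growth_fin (T : finType) (b : T -> S) J t r C :
  (forall i, deg_lt t (b i)) -> indep J b -> (t ^ r <= C * #|T|)%N ->
  exists k (b : 'I_k -> S), [/\ forall i, deg_lt t (b i), indep J b & (t ^ r <= C * k)%N].
Proof.
move=> bt ib le_t; exists #|T|, (b \o enum_val); split => // [i|]; first exact: bt.
by apply: indep_bij ib; exact: enum_val_bij.
Qed.

Lemma growth_le J r : subspace J -> growth J r -> (r <= n)%N.
Proof.
move=> sJ [C /(_ C.+1)[t ltCt [k [b [bt ib le_t]]]]].
rewrite leqNgt; apply/negP => lt_nr.
have := indep_deg_lt sJ bt ib; rewrite card_ord => le_k.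
have t0 : (0 < t)%N by apply: leq_trans ltCt.
have : (t * t ^ n <= C * t ^ n)%N.
  rewrite -expnS; apply: leq_trans (_ : t ^ r <= _)%N; first by rewrite leq_pexp2l.
  by apply: leq_trans le_t _; rewrite leq_mul2l le_k orbT.
by rewrite leq_pmul2r ?expn_gt0 ?t0 // leqNgt ltCt.
Qed.

(** An element [q] of [Q] that is a nonzerodivisor modulo [P]: the products of
    powers of [q] with elements independent modulo [Q] are independent modulo
    [P], because setting [q] to zero isolates the lowest power. *)
Lemma growth_nonzerodivisor P Q q s : ideal_set P -> ideal_set Q ->
  (forall x, P x -> Q x) -> Q q -> (forall x, P (q * x) -> P x) ->
  growth Q s -> growth P s.+1.
Proof.
move=> idP idQ PQ Qq nzd [C CP].
pose D := (msize q + 1)%N; exists (D ^ s.+1 * C)%N => N.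
have [t leNt [k [b [bt ib le_t]]]] := CP N.
exists (t * D)%N; first by apply: leq_trans leNt _; rewrite leq_pmulr // /D addn1.
have q_neq0 (i : 'I_k) : q != 0.
  apply/eqP => q0; have Px x : P x by apply: nzd; rewrite q0 mul0r; apply: ideal_set0.
  have /eqP := ib (fun=> 1) (PQ _ (Px _)) i.
  by rewrite oner_eq0.
pose B (x : 'I_t * 'I_k) := q ^+ x.1 * b x.2.
apply: (@growth_fin _ B).
- case=> e i; rewrite /B /= mulnDr muln1; apply: deg_ltM (bt i).
  apply: (@deg_ltW (e.+1 * msize q)); first by rewrite leq_mul2r ltn_ord orbT.
  elim: {e}(e : nat) => [|e IH]; last by rewrite exprS mulSn; apply: deg_ltM IH; apply: leqnn.
  rewrite expr0 mul1n /deg_lt /= msize1 lt0n msize_poly_eq0; apply: q_neq0 i.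
- move=> c; suff key : forall u (c' : nat -> 'I_k -> K),
      P (\sum_(e < u) q ^+ e * lincomb b (c' e)) -> forall e i, (e < u)%N -> c' e i = 0.
    move=> Pc [e i].
    pose c' (e : nat) i := if insub e is Some e' then c (e', i) else 0 : K.
    have <- : c' e i = c (e, i) by rewrite /c' valK.
    apply: key (ltn_ord e); rewrite (_ : \sum_(_ < t) _ = lincomb B c) //.
    transitivity (\sum_e \sum_i c (e, i) *: B (e, i)); last first.
      by rewrite pair_bigA; apply: eq_bigr => -[].
    apply: eq_bigr => e' _; rewrite mulr_sumr; apply: eq_bigr => i' _.
    by rewrite /c' valK -scalerAr.
  elim=> [|u IH] c' //; rewrite big_ord_recl /= expr0 mul1r.
  have -> : \sum_(e < u) q ^+ (bump 0 e) * lincomb b (c' (bump 0 e))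
      = q * \sum_(e < u) q ^+ e * lincomb b (c' e.+1).
    by rewrite mulr_sumr; apply: eq_bigr => e _; rewrite /bump /= add1n exprS mulrA.
  move=> Pc; have c0 : forall i, c' 0%N i = 0.
    apply: ib; have := PQ _ Pc; set X := _ * _ => QX.
    rewrite -[lincomb _ _](addrK X); apply: (subspaceB (ideal_set_sub idQ)) => //.
    by rewrite /X mulrC; apply: ideal_setM.
  have l0 : lincomb b (c' 0%N) = 0.
    by rewrite /lincomb big1 // => i _; rewrite c0 scale0r.
  move: Pc; rewrite l0 add0r => /nzd Pc [|e] i; first by rewrite c0.
  exact: (IH (fun e => c' e.+1)).
rewrite card_prod !card_ord expnMn mulnC [(t ^ s.+1)%N]expnS -[leqRHS]mulnA.
by rewrite [(C * _)%N]mulnCA !leq_mul.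
Qed.

Lemma growth0 J : ideal_set J -> ~ J 1 -> growth J 0.
Proof.
move=> idJ J1; exists 1%N => N; exists N.+1 => //.
apply: (@growth_fin 'I_1 (fun=> 1)) => [i||]; last by rewrite card_ord.
  by rewrite /deg_lt /= msize1.
move=> c; rewrite /lincomb big_ord1 => Jc i; rewrite ord1.
apply/eqP; apply: contraT => c0; case: J1.
have /(ideal_setM idJ ((c ord0)^-1)%:MP) := Jc.
by rewrite mul_mpolyC scalerA mulVf // scale1r.
Qed.

End Growth.

Section HomogeneousPrimes.
Variables (K : fieldType) (n : nat).
Notation S := {mpoly K[n]}.
Implicit Types (J P Q : set S) (p q f g : S).

Definition homogeneous_set J := forall p d, J p -> J (pihomog mdeg d p).

Definition prime_set P :=
  [/\ ideal_set P, ~ P 1 & forall p q, P (p * q) -> P p \/ P q].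

Definition ideal_add J f : set S := [set p | exists u, J (p - f * u)]%classic.

Lemma ideal_add_ideal J f : ideal_set J -> ideal_set (ideal_add J f).
Proof.
move=> idJ; split; first by exists 0; rewrite mulr0 subr0; apply: ideal_set0.
move=> a x y [u Ju] [v Jv]; exists (a * u + v).
have -> : a * x + y - f * (a * u + v) = a * (x - f * u) + (y - f * v) by ring.
exact: idJ.2.
Qed.

Lemma ideal_add_sub J f p : J p -> ideal_add J f p.
Proof. by move=> Jp; exists 0; rewrite mulr0 subr0. Qed.

Lemma ideal_add_mem J f : ideal_set J -> ideal_add J f f.
Proof. by move=> idJ; exists 1; rewrite mulr1 subrr; apply: ideal_set0. Qed.

Lemma ideal_add_homogeneous J f e : f \is e.-homog -> homogeneous_set J ->
  homogeneous_set (ideal_add J f).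
Proof.
move=> fe hJ p d [u Ju]; exists (hpart d e u).
by rewrite mulrC -pihomogMl // mulrC -linearB; apply: hJ.
Qed.

(** Keeping the components of degree less than [t] in [p - f * u]. *)
Lemma homogeneous_truncate J f e t p u : ideal_set J -> homogeneous_set J ->
  f \is e.-homog -> deg_lt t p -> J (p - f * u) ->
  exists2 u', deg_lt (t - e) u' & J (p - f * u').
Proof.
move=> idJ hJ fe pt Ju.
exists (\sum_(d < t) hpart d e u).
  apply: (subspace_sum (deg_lt_sub _ _ _)) => -[d ltd] _ /=.
  rewrite /hpart; case: ifP => led; last by rewrite /deg_lt /= msize0.
  rewrite /deg_lt /= msizeE; apply/bigmax_leqP_seq => b bs _.
  by rewrite (dhomog_mf (pihomogP _ _ _) bs); lia.
rewrite [p](pihomog_partitionE pt) mulrC mulr_suml -sumrB.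
apply: (subspace_sum (ideal_set_sub idJ)) => d _.
by rewrite -pihomogMl // mulrC -linearB; apply: hJ.
Qed.

(** Counting along [S/(P + g) -> S/P -> S/(P + f)], the first map being
    multiplication by [f]. *)
Lemma deg_lt_basis_mul P f g e e' t k1 k2 (w1 : 'I_k1 -> S) (w2 : 'I_k2 -> S)
    k (b : 'I_k -> S) :
  ideal_set P -> homogeneous_set P -> f \is e.-homog -> g \is e'.-homog -> P (f * g) ->
  fbasis (deg_lt t) (ideal_add P f) w1 -> fbasis (deg_lt t) (ideal_add P g) w2 ->
  (forall i, deg_lt t (b i)) -> indep P b -> (k <= k1 + k2)%N.
Proof.
move=> idP hP fe ge Pfg [w1t s1 _] [w2t s2 _] bt ib.
pose w x := match x with inl i => w1 i | inr i => f * w2 i end.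
rewrite -[k]card_ord -[k1]card_ord -[k2]card_ord -card_sum.
apply: (indep_leq (b2 := w) (ideal_set_sub idP) ib) => i.
have [c [u0 Pu0]] := s1 _ (bt i).
have [|u ut Pu] := homogeneous_truncate (t := t) idP hP fe _ Pu0.
  by apply: (subspaceB (deg_lt_sub _ _ t)) => //; apply: subspace_lincomb => //; apply: deg_lt_sub.
have [c' [v Pv]] := s2 u (deg_ltW (leq_subr e t) ut).
exists (fun x => match x with inl i => c i | inr i => c' i end).
have -> : lincomb w (fun x => match x with inl i => c i | inr i => c' i end)
    = lincomb w1 c + f * lincomb w2 c'.
  rewrite /lincomb big_sumType mulr_sumr; congr (_ + _).
  by apply: eq_bigr => j _; rewrite scalerAr.
have -> : b i - (lincomb w1 c + f * lincomb w2 c')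
   = (b i - lincomb w1 c - f * u) + (f * (u - lincomb w2 c' - g * v) + v * (f * g)) by ring.
apply: ideal_setD => //; apply: ideal_setD => //; exact: ideal_setM.
Qed.

(** One of the two terms of the preceding estimate is at least half of the sum,
    for the same [t]. *)
Lemma growth_mul P f g e e' r :
  ideal_set P -> homogeneous_set P -> f \is e.-homog -> g \is e'.-homog -> P (f * g) ->
  growth P r -> growth (ideal_add P f) r \/ growth (ideal_add P g) r.
Proof.
move=> idP hP fe ge Pfg [C CP]; apply: contrapT => /not_orP[nf ng].
have bound h : ~ growth (ideal_add P h) r -> exists N, forall t, (N <= t)%N ->
    forall k (b : 'I_k -> S), (forall i, deg_lt t (b i)) -> indep (ideal_add P h) b ->
    ((2 * C) * k < t ^ r)%N.
  move=> nh; apply: contrapT => nex; apply: nh; exists (2 * C)%N => N.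
  apply: contrapT => nt; apply: nex; exists N => t leNt k b bt ib.
  rewrite ltnNge; apply/negP => le_t; apply: nt; exists t => //.
  by exists k, b.
have [N1 N1P] := bound _ nf; have [N2 N2P] := bound _ ng.
have [t lt [k [b [bt ib le_t]]]] := CP (N1 + N2)%N.
have [k1 [w1 fw1]] := exists_deg_lt_basis t (ideal_set_sub (ideal_add_ideal f idP)).
have [k2 [w2 fw2]] := exists_deg_lt_basis t (ideal_set_sub (ideal_add_ideal g idP)).
have := deg_lt_basis_mul idP hP fe ge Pfg fw1 fw2 bt ib.
have [w1t _ i1] := fw1; have [w2t _ i2] := fw2.
have := N1P t (leq_trans (leq_addr _ _) lt) _ _ w1t i1.
have := N2P t (leq_trans (leq_addl _ _) lt) _ _ w2t i2.
move: le_t; nia.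
Qed.

(** Modulo [P], every element of degree less than [t] is a combination of
    products [x ^ j * w] with [w] in a basis modulo [P + x]; truncating these
    products leaves only the exponents [j < t]. *)
Lemma growth_form P x e r : ideal_set P -> homogeneous_set P -> (0 < e)%N -> x \is e.-homog ->
  growth P r.+1 -> growth (ideal_add P x) r.
Proof.
move=> idP hP e0 xe [C CP]; exists C => N.
have [t leNt [k [b [bt ib le_t]]]] := CP N.+1; exists t; first exact: ltnW.
have [k1 [w [wt sw iw]]] := exists_deg_lt_basis t (ideal_set_sub (ideal_add_ideal x idP)).
exists k1, w; split=> //.
pose trunc (p : S) : S := \sum_(d < t) pihomog mdeg d p.
have truncB p q : trunc (p - q) = trunc p - trunc q.
  by rewrite /trunc -sumrB; apply: eq_bigr => d _; rewrite linearB.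
pose B (y : 'I_t * 'I_k1) : S := trunc (x ^+ y.1 * w y.2).
have iter_span p j : deg_lt t p -> exists (c : nat -> 'I_k1 -> K) u,
    P (p - \sum_(i < j) x ^+ i * lincomb w (c i) - x ^+ j * u) /\ deg_lt t u.
  move=> pt; elim: j => [|j [c [u [Pu ut]]]].
    exists (fun _ _ => 0), p; rewrite big_ord0 subr0 mul1r subrr.
    by split=> //; apply: ideal_set0.
  have [c' [v0 Pv0]] := sw u ut.
  have [|v vt Pv] := homogeneous_truncate (t := t) idP hP xe _ Pv0.
    apply: (subspaceB (deg_lt_sub _ _ t)) => //.
    by apply: subspace_lincomb => //; apply: deg_lt_sub.
  exists (fun i => if (i < j)%N then c i else c'), v; split; last exact: deg_ltW (leq_subr _ _) vt.
  rewrite big_ord_recr /= ltnn; under eq_bigr do rewrite ltn_ord.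
  set X := \sum_(i < j) _ in Pu *.
  have -> : p - (X + x ^+ j * lincomb w c') - x ^+ j.+1 * v
      = p - X - x ^+ j * u + x ^+ j * (u - lincomb w c' - x * v) by rewrite exprS; ring.
  by apply: ideal_setD => //; apply: ideal_setM.
have le_k : (k <= t * k1)%N.
  rewrite -[k]card_ord -[t]card_ord -[k1]card_ord -card_prod.
  apply: (indep_leq (b2 := B) (ideal_set_sub idP) ib) => i.
  have [c [u [Pu _]]] := iter_span _ t (bt i).
  exists (fun y : 'I_t * 'I_k1 => c y.1 y.2).
  have : P (trunc (b i - \sum_(i < t) x ^+ i * lincomb w (c i) - x ^+ t * u)).
    by apply: (subspace_sum (ideal_set_sub idP)) => d _; apply: hP.
  have -> : trunc (b i - \sum_(j < t) x ^+ j * lincomb w (c j) - x ^+ t * u)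
      = b i - trunc (\sum_(j < t) x ^+ j * lincomb w (c j)) - trunc (x ^+ t * u).
    rewrite !truncB; congr (_ - _ - _).
    by apply/esym/pihomog_partitionE; apply: bt.
  have -> : trunc (x ^+ t * u) = 0.
    rewrite /trunc big1 // => -[d ltd] _ /=; rewrite mulrC.
    rewrite (@pihomogMl _ _ d (e * t)); last exact: dhomogMn.
    by rewrite /hpart leqNgt (leq_trans ltd) ?leq_pmull // mul0r.
  rewrite subr0; congr (P (_ - _)).
  transitivity (\sum_(j < t) \sum_l c j l *: B (j, l)); last first.
    by rewrite pair_bigA; apply: eq_bigr => -[].
  rewrite /trunc; under eq_bigr do rewrite linear_sum.
  rewrite exchange_big; apply: eq_bigr => j _ /=.
  under [RHS]eq_bigr do rewrite /B /trunc scaler_sumr.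
  rewrite [RHS]exchange_big; apply: eq_bigr => d _ /=.
  rewrite mulr_sumr linear_sum; apply: eq_bigr => l _.
  by rewrite -linearZ scalerAr.
have t0 : (0 < t)%N by apply: leq_ltn_trans leNt.
rewrite -(leq_pmul2l t0) -expnS mulnCA; apply: leq_trans le_t _.
by rewrite leq_mul2l le_k orbT.
Qed.

End HomogeneousPrimes.

Section PrimeChains.
Variables (K : fieldType) (n : nat).
Notation S := {mpoly K[n]}.
Implicit Types (J P Q : set S) (p q f g : S).

(** Otherwise a strictly increasing sequence exists; its union is generated by
    finitely many elements, which already lie in one member. *)
Lemma exists_maximal_ideal (A : set (set S)) J : (forall J, A J -> ideal_set J) -> A J ->
  exists P, [/\ A P, forall p, J p -> P p &
    forall Q, A Q -> (forall p, P p -> Q p) -> forall p, Q p -> P p].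
Proof.
move=> idA AJ; apply: contrapT => nmax.
pose T := {P | A P /\ forall p, J p -> P p}.
have /choice[next nextP] : forall X : T, exists Y : T,
    (forall p, sval X p -> sval Y p) /\ exists2 p, sval Y p & ~ sval X p.
  move=> [P [AP JP]] /=; apply: contrapT => nY; apply: nmax.
  exists P; split=> // Q AQ PQ p Qp; apply: contrapT => nPp; apply: nY.
  have QT : A Q /\ forall p, J p -> Q p by split=> // ? /JP/PQ.
  by exists (exist _ Q QT); split=> //; exists p.
pose u k := iter k next (exist _ J (conj AJ (fun _ => id)) : T).
have uM i j p : (i <= j)%N -> sval (u i) p -> sval (u j) p.
  elim: j => [|j IH]; first by rewrite leqn0 => /eqP ->.
  rewrite leq_eqVlt => /orP[/eqP -> //|/IH h /h].
  by case: (nextP (u j)) => h' _; exact: h'.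
have idu k : ideal_set (sval (u k)) by case: (u k) => P [/= /idA].
have [|I [f [fI fP]]] := @hilbert_basis K n [set p | exists k, sval (u k) p]%classic.
  split; first by exists 0%N; apply: ideal_set0.
  move=> a x y [k xk] [l yl]; exists (maxn k l); apply: (idu _).2.
    by apply: uM xk; rewrite leq_maxl.
  by apply: uM yl; rewrite leq_maxr.
have /choice[k kP] := fI.
pose M := (\max_i k i)%N.
have [_ [p pS nMp]] := nextP (u M); case: nMp.
have [|c ->] := fP p; first by exists M.+1.
apply: (big_ind (sval (u M))); [exact: ideal_set0|exact: ideal_setD|].
move=> i _; apply: ideal_setM => //; apply: uM (kP i).
by rewrite /M (bigD1 i) //= leq_maxl.
Qed.

(** The top components multiply to a component of [p * q], so one of them lies in
    [P]; subtracting it lowers a degree. *)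
Lemma homogeneous_prime P : ideal_set P -> homogeneous_set P ->
  (forall d e f g, f \is d.-homog -> g \is e.-homog -> P (f * g) -> P f \/ P g) ->
  forall p q, P (p * q) -> P p \/ P q.
Proof.
move=> idP hP prP p q.
have sP := ideal_set_sub idP.
suff key s t : deg_lt s p -> deg_lt t q -> P (p * q) -> P p \/ P q.
  exact: (key _ _ (leqnn (msize p)) (leqnn (msize q))).
move: {2}(s + t)%N (leqnn (s + t)) => k; elim: k s t p q => [|k IH] s t p q.
  rewrite leqn0 addn_eq0 => /andP[/eqP -> _].
  by rewrite /deg_lt /= leqn0 msize_poly_eq0 => /eqP -> _ _; left; apply: ideal_set0.
have zero r : deg_lt 0 r -> P r.
  by rewrite /deg_lt /= leqn0 msize_poly_eq0 => /eqP ->; apply: ideal_set0.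
case: s => [|s]; first by move=> _ /zero; left.
case: t => [|t]; first by move=> _ _ /zero; right.
move=> le_k ps qt Ppq.
have top u (r : S) : deg_lt u.+1 r -> deg_lt u (r - pihomog mdeg u r).
  move=> ru; rewrite {1}(pihomog_partitionE ru) big_ord_recr /= addrK.
  apply: (subspace_sum (deg_lt_sub _ _ _)) => -[d ltd] _ /=.
  rewrite /deg_lt /= msizeE; apply/bigmax_leqP_seq => b bs _.
  by rewrite (dhomog_mf (pihomogP _ _ _) bs).
have Ptop : P (pihomog mdeg s p * pihomog mdeg t q).
  have -> : pihomog mdeg s p * pihomog mdeg t q = pihomog mdeg (s + t) (p * q).
    rewrite -[q in RHS](subrK (pihomog mdeg t q)) mulrDr linearD /=.
    rewrite [X in X + _](_ : _ = 0) ?add0r; last first.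
      have := @hpart_large _ _ (s + t) 0 (p * (q - pihomog mdeg t q)) (s + t).
      rewrite /hpart leq0n subn0; apply => //.
      by have := deg_ltM_pred ps (top _ _ qt); rewrite addSn.
    by rewrite (pihomogMl _ _ (pihomogP _ t q)) /hpart leq_addl addnK.
  exact: hP.
have [] := prP _ _ _ _ (pihomogP _ s p) (pihomogP _ t q) Ptop => Ph.
  have [||||h|h] := IH s t.+1 (p - pihomog mdeg s p) q.
  - by move: le_k; rewrite addSn ltnS.
  - exact: top.
  - by [].
  - by rewrite mulrBl [X in _ - X]mulrC; apply: (subspaceB sP) => //; apply: ideal_setM.
  - by left; rewrite -[p](subrK (pihomog mdeg s p)); apply: ideal_setD.
  - by right.
have [||||h|h] := IH s.+1 t p (q - pihomog mdeg t q).
- by move: le_k; rewrite addnS ltnS.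
- by [].
- exact: top.
- by rewrite mulrBr; apply: (subspaceB sP) => //; apply: ideal_setM.
- by left.
- by right; rewrite -[q](subrK (pihomog mdeg t q)); apply: ideal_setD.
Qed.

(** A homogeneous ideal maximal among those of growth at least [r] is prime. *)
Lemma exists_homogeneous_prime J r : ideal_set J -> homogeneous_set J -> growth J r ->
  exists P, [/\ prime_set P, homogeneous_set P, forall p, J p -> P p & growth P r].
Proof.
move=> idJ hJ gJ.
have [||P [[idP hP gP] JP maxP]] := @exists_maximal_ideal
  [set J | [/\ ideal_set J, homogeneous_set J & growth J r]]%classic J.
- by move=> ? [].
- by [].
exists P; split=> //; split=> //.
  move=> P1; have [C /(_ 1%N)[t t0 [k [b [_ ib le_t]]]]] := gP.
  have Pl : P (lincomb b (fun=> 1)) by rewrite -[lincomb _ _]mulr1; apply: ideal_setM.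
  case: k b ib le_t Pl => [|k] b ib le_t Pl; last first.
    by have /eqP := ib _ Pl ord0; rewrite oner_eq0.
  by move: le_t; rewrite muln0 leqn0 expn_eq0 -leqn0 leqNgt t0.
apply: homogeneous_prime => // d e f g fd ge Pfg.
have sub h c : h \is c.-homog -> growth (ideal_add P h) r -> P h.
  move=> hc gh; apply: (maxP (ideal_add P h)); last exact: ideal_add_mem.
    by split=> //; [exact: ideal_add_ideal|exact: ideal_add_homogeneous hc hP].
  exact: ideal_add_sub.
by have [/(sub _ _ fd)|/(sub _ _ ge)] := growth_mul idP hP fd ge Pfg gP; [left|right].
Qed.

(** Cutting with a variable outside the prime lowers the growth by one. Such a
    variable exists as long as the growth is positive: modulo a proper ideal that
    contains all variables only constants are left. *)
Lemma exists_prime_chain J r : ideal_set J -> homogeneous_set J -> growth J r ->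
  exists c : nat -> set S, [/\ forall i, prime_set (c i), forall i p, J p -> c i p &
    forall i, (i < r)%N -> (forall p, c i p -> c i.+1 p) /\ exists2 p, c i.+1 p & ~ c i p].
Proof.
elim: r J => [|r IH] J idJ hJ gJ; have [P [prP hP JP gP]] := exists_homogeneous_prime idJ hJ gJ.
  by exists (fun=> P); split.
have [idP P1 _] := prP.
have [i nPi] : exists i : 'I_n, ~ P 'X_i.
  apply: contrapT => nex.
  have [C /(_ C.+1)[t ltCt [k [b [_ ib le_t]]]]] := gP.
  have Pm (m : 'X_{1..n}) : m != 0%MM -> P 'X_[m].
    move=> m0; have [i mi] : exists i, (U_(i) <= m)%MM.
      apply: contrapT => nx; case/eqP: m0; apply/mnmP => i; rewrite mnm0E; apply/eqP.
      by apply: contraT => mi; case: nx; exists i; rewrite lep1mP.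
    rewrite -(submK mi) mpolyXD; apply: ideal_setM => //.
    by apply: contrapT => nPi; apply: nex; exists i.
  have : (#|{: 'I_k}| <= #|{: 'I_1}|)%N.
    apply: (indep_leq (b2 := fun=> 1) (ideal_set_sub idP) ib) => i.
    exists (fun=> (b i)@_0%MM); rewrite /lincomb big_ord1.
    rewrite {1}[b i]mpolyE (bigID (fun m => m == 0%MM)) /= addrC.
    set X := \sum_(m <- _ | m != _) _; have PX : P X.
      by apply: (subspace_sum (ideal_set_sub idP)) => m m0; apply: subspaceZ (ideal_set_sub idP) _ _ (Pm _ m0).
    rewrite -addrA; apply: ideal_setD => //.
    have -> : \sum_(m <- msupp (b i) | m == 0%MM) (b i)@_m *: 'X_[m] = (b i)@_0%MM *: 1.
      rewrite -big_filter; have [b0|b0] := boolP (0%MM \in msupp (b i)).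
        by rewrite (filter_pred1_uniq (msupp_uniq _) b0) big_seq1 mpolyX0.
      rewrite [filter _ _](_ : _ = [::]) ?big_nil ?memN_msupp_eq0 ?scale0r //.
      by apply/eqP; rewrite -size_eq0 size_filter -leqn0 leqNgt -has_count has_pred1.
    by rewrite subrr; apply: ideal_set0.
  rewrite !card_ord => k1; have : (t ^ r.+1 <= C)%N.
    by apply: leq_trans le_t _; rewrite -[leqRHS]muln1 leq_mul2l k1 orbT.
  have t0 : (0 < t)%N by apply: leq_ltn_trans ltCt.
  by rewrite leqNgt (leq_trans ltCt) // expnS leq_pmulr // expn_gt0 t0.
have Xi : ('X_i : S) \is 1.-homog by rewrite dhomogX; apply/eqP/mdeg1.
have [||c [prc Jc strict]] := IH (ideal_add P 'X_i) (ideal_add_ideal _ idP).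
- exact: ideal_add_homogeneous Xi hP.
- exact: growth_form (ltn0Sn 0) Xi gP.
exists (fun j => if j is j'.+1 then c j' else P); split.
- by case.
- by case=> [|j] p /JP // /(ideal_add_sub 'X_i); apply: Jc.
- case=> [_|j]; last exact: strict.
  split=> [p /(ideal_add_sub 'X_i)|]; first exact: Jc.
  by exists 'X_i => //; apply/Jc/ideal_add_mem.
Qed.

End PrimeChains.

Section PrimeIdealOfSet.
Variables (R : comNzRingType) (P : set R).
Hypotheses (P0 : P 0) (PD : forall a x y, P x -> P y -> P (a * x + y)) (P1 : ~ P 1)
  (PM : forall x y, P (x * y) -> P x \/ P y).

Definition bool_of_set : R -> bool := fun x => `[< P x >].

Lemma bool_of_set_idealr : idealr_closed bool_of_set.
Proof.
split; [exact/asboolP|exact/asboolPn|move=> a x y /asboolP Px /asboolP Py].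
exact/asboolP/PD.
Qed.

Lemma bool_of_set_prime : prime_idealr_closed bool_of_set.
Proof. by move=> x y /asboolP/PM[Px|Py]; apply/orP; [left|right]; apply/asboolP. Qed.

HB.instance Definition _ := isIdealr.Build R bool_of_set bool_of_set_idealr.
HB.instance Definition _ := isPrimeIdealrClosed.Build R bool_of_set bool_of_set_prime.

Lemma exists_prime_idealr : exists Q : prime_idealr R, forall x, x \in Q <-> P x.
Proof.
by exists bool_of_set => x; split=> [/asboolP|Px] //; apply/asboolP.
Qed.

End PrimeIdealOfSet.

Section KrullDimension.
Variables (K : fieldType) (n : nat).
Notation S := {mpoly K[n]}.

Lemma idealr_set (I : idealr S) : ideal_set [set` I]%classic.
Proof.
split=> [|a x y xI yI] /=; first exact: idealr0.
by rewrite rpredD ?idealMr.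
Qed.

Lemma prime_idealr_set (P : prime_idealr S) : prime_set [set` P]%classic.
Proof.
split=> [||p q] /=; first exact: idealr_set.
  by rewrite idealr1.
by rewrite prime_idealrM => /orP.
Qed.

(** Going down one step in the chain, an element of the larger prime outside the
    smaller one is a nonzerodivisor modulo the latter. *)
Lemma growth_chain k (c : nat -> prime_idealr S) s : prime_chain k c ->
  growth [set` c k]%classic s -> growth [set` c 0%N]%classic (k + s).
Proof.
elim: k c s => [|k IH] c s // ck gk.
have [sub nsub] := ck k (ltnSn k).
rewrite addSnnS; apply: IH => [i ik|]; first by apply: ck; apply: ltnW.
have [q Qq nPq] : exists2 q, q \in c k.+1 & q \notin c k.
  apply: contrapT => nex; apply: nsub => q Qq; apply: contrapT => /negP nPq.
  by apply: nex; exists q.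
apply: (growth_nonzerodivisor (q := q)) gk => //=; try exact: idealr_set.
by move=> x; rewrite prime_idealrM (negPf nPq).
Qed.

(** The height of [P] is finite because growth bounds the length of chains
    below it; so the height of [I] bounds it from below. *)
Lemma growth_height (I : idealr S) h (P : prime_idealr S) s :
  ideal_height I h -> {subset I <= P} -> growth [set` P]%classic s -> (h + s <= n)%N.
Proof.
move=> [_ minh] IP gP.
have bound k c : prime_chain k c -> c k =i P -> (k + s <= n)%N.
  move=> ck cP; apply: (@growth_le _ _ [set` c 0%N]%classic).
    exact/ideal_set_sub/idealr_set.
  apply: growth_chain ck _; rewrite (_ : [set` c k]%classic = [set` P]%classic) //.
  by apply/seteqP; split=> x /=; rewrite cP.
pose A k := `[< exists2 c, prime_chain k c & c k =i P >].
have A0 : exists k, A k by exists 0%N; apply/asboolP; exists (fun=> P).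
have An k : A k -> (k <= n)%N.
  by move=> /asboolP[c ck /(bound _ _ ck)]; apply: leq_trans; apply: leq_addr.
case: (ex_maxnP A0 An) => k /asboolP[c ck cP] kmax.
have hP : prime_height P k.
  by split=> [|l e el eP]; [exists c|apply: kmax; apply/asboolP; exists e].
by apply: leq_trans (bound _ _ ck cP); rewrite leq_add2r (minh P).
Qed.

Variable I : idealr S.

Lemma quot_eq0 x : (\pi_({ideal_quot I})%qT x == 0) = (x \in I).
Proof. by rewrite -[x in RHS]subr0 Quotient.idealrBE rmorph0. Qed.

Lemma quot_repr_sub x : repr (\pi_({ideal_quot I})%qT x) - x \in I.
Proof. by rewrite Quotient.idealrBE reprK. Qed.

Lemma prime_pullback (P : prime_idealr {ideal_quot I}) : exists Q : prime_idealr S,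
  forall x, x \in Q <-> \pi_({ideal_quot I})%qT x \in P.
Proof.
have [||||Q QP] := @exists_prime_idealr _ [set x | \pi_({ideal_quot I})%qT x \in P]%classic.
- by rewrite /= rmorph0 idealr0.
- by move=> a x y xP yP; rewrite /= rmorphD rmorphM rpredD ?idealMr.
- by rewrite /= rmorph1 idealr1.
- by move=> x y; rewrite /= rmorphM prime_idealrM => /orP.
- by exists Q.
Qed.

Lemma prime_pushforward (Q : set S) : prime_set Q -> (forall x, x \in I -> Q x) ->
  exists P : prime_idealr {ideal_quot I}, forall x, \pi_({ideal_quot I})%qT x \in P <-> Q x.
Proof.
move=> [idQ Q1 QM] IQ.
have Qrepr x : Q (repr (\pi_({ideal_quot I})%qT x)) <-> Q x.
  split=> Qx.
    rewrite -[x](subKr (repr (\pi_({ideal_quot I})%qT x))).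
    apply: (subspaceB (ideal_set_sub idQ)) => //; apply: IQ; apply: quot_repr_sub.
  by rewrite -[X in Q X](subrK x); apply: (ideal_setD idQ) => //; apply/IQ/quot_repr_sub.
have [||||P PP] := @exists_prime_idealr _ [set y : {ideal_quot I} | Q (repr y)]%classic.
- rewrite /= -(rmorph0 \pi_({ideal_quot I})%qT); exact/Qrepr/(ideal_set0 idQ).
- move=> a x y Qx Qy; rewrite /= -[a]reprK -[x]reprK -[y]reprK -rmorphM -rmorphD.
  exact/Qrepr/idQ.2.
- by rewrite /= -(rmorph1 \pi_({ideal_quot I})%qT) => /Qrepr.
- by move=> x y; rewrite /= -{1}[x]reprK -{1}[y]reprK -rmorphM => /Qrepr/QM.
- by exists P => x; split=> [/PP/Qrepr|Qx] //; apply/PP/Qrepr.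
Qed.

Lemma krull_dim_le d h : ideal_height I h -> krull_dim {ideal_quot I} d -> (h + d <= n)%N.
Proof.
move=> hI [[c cd] _].
have /choice[Q QP] := fun i => prime_pullback (c i).
have chainQ : prime_chain d Q.
  move=> i /cd[sub nsub]; split=> [x /QP/sub|subQ]; first by move/QP.
  by apply: nsub => y; rewrite -[y]reprK => /QP/subQ/QP.
apply: (@growth_height I h (Q 0%N)) => //.
  by move=> x xI; apply/QP; move: xI; rewrite -quot_eq0 => /eqP ->; apply: idealr0.
rewrite -[d]addn0; apply: growth_chain chainQ _.
have [idQ Q1 _] := prime_idealr_set (Q d); exact: growth0.
Qed.

Lemma le_krull_dim d r : homogeneous_ideal I -> growth [set` I]%classic r ->
  krull_dim {ideal_quot I} d -> (r <= d)%N.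
Proof.
move=> hI gI [_ maxd].
have [c [prc Ic strict]] := exists_prime_chain (idealr_set I) hI gI.
have /choice[P PP] : forall i, exists P : prime_idealr {ideal_quot I},
    forall x, \pi_({ideal_quot I})%qT x \in P <-> c i x.
  by move=> i; apply: prime_pushforward => // x; apply: Ic.
apply: (maxd r P) => i /strict[sub [q qi nqi]]; split.
  by move=> y; rewrite -[y]reprK => /PP/sub/PP.
by move=> /(_ (\pi_({ideal_quot I})%qT q)) s; apply: nqi; apply/PP/s/PP.
Qed.

Lemma growth_ideal_height h r : homogeneous_ideal I -> ideal_height I h ->
  growth [set` I]%classic r -> (h + r <= n)%N.
Proof.
move=> hI htI gI.
have [P [[idP P1 PM] _ IP gP]] := exists_homogeneous_prime (idealr_set I) hI gI.
have [Q QP] := exists_prime_idealr idP.1 idP.2 P1 PM.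
apply: (@growth_height I h Q) => //; first by move=> x /IP/QP.
by rewrite (_ : [set` Q]%classic = P) //; apply/seteqP; split=> x /= /QP.
Qed.

End KrullDimension.

(** * The Hilbert function of a free resolution *)

Section FormsBasis.
Variables (K : fieldType) (n : nat).
Notation S := {mpoly K[n]}.

(** Monomials of degree [d - a]; written as a sum, the condition fails when
    [d < a]. *)
Definition mono_shift d a := {b : 'X_{1..n < d.+1} | (mdeg b + a == d)%N}.

Variables (m : nat) (a : 'I_m -> nat).
Notation V := {ffun 'I_m -> S}.

Definition shifted_forms d : set V := vhomog a d.

Lemma shifted_forms_sub d : subspace (shifted_forms d : set V).
Proof.
split=> [i|c u v uh vh i].
  by rewrite ffunE /homog_shift; case: ifP => _; rewrite ?dhomog0 ?eqxx.
rewrite !ffunE /homog_shift; move: (uh i) (vh i); rewrite /homog_shift.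
case: ifP => _; last by move=> /eqP -> /eqP ->; rewrite scaler0 addr0.
by move=> h1 h2; apply: rpredD => //; apply: rpredZ.
Qed.

Definition shifted_mono d (t : {i : 'I_m & mono_shift d (a i)}) : V :=
  [ffun i => if i == tag t then 'X_[val (tagged t)] else 0].

Lemma lincomb_shifted_mono d (c : {i : 'I_m & mono_shift d (a i)} -> K) i :
  lincomb (@shifted_mono d) c i = \sum_(t : mono_shift d (a i)) c (existT (fun i => mono_shift d (a i)) i t) *: 'X_[val t].
Proof.
rewrite /lincomb sum_ffunE.
transitivity (\sum_j \sum_(t : mono_shift d (a j))
    (c (existT (fun i => mono_shift d (a i)) j t) *:
     shifted_mono (existT (fun i => mono_shift d (a i)) j t)) i).
  by rewrite (sig_big_dep _ (fun _ => xpredT)); apply: eq_bigr => -[].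
rewrite (bigD1 i) //= [X in _ + X]big1 ?addr0.
  by apply: eq_bigr => t _; rewrite !ffunE eqxx.
move=> j ji; rewrite big1 // => t _.
by rewrite !ffunE /= eq_sym (negPf ji) scaler0.
Qed.

Lemma shifted_forms_basis d : fbasis (shifted_forms d) [set 0]%classic (@shifted_mono d).
Proof.
split.
- move=> [i [b /= bi]] j; rewrite ffunE /homog_shift /=.
  case: eqP => [->|_]; last by case: ifP; rewrite ?dhomog0 ?eqxx.
  have le_ai : (a i <= d)%N by rewrite -(eqP bi) leq_addl.
  by rewrite le_ai dhomogX; apply/eqP; rewrite -{2}(eqP bi) addnK.
- move=> u uh; exists (fun t : {i : 'I_m & mono_shift d (a i)} => (u (tag t))@_(val (tagged t))).
  apply/ffunP => i; rewrite !ffunE lincomb_shifted_mono /=; apply/eqP; rewrite subr_eq0; apply/eqP.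
  have := uh i; rewrite /homog_shift; case: ifP => [le_ai hi|/negbT nle /eqP ->]; last first.
    by rewrite big1 // => -[b /= bi] _; rewrite mcoeff0 scale0r.
  apply/mpolyP => b; rewrite raddf_sum /=.
  have [bi|bi] := eqVneq (mdeg b + a i)%N d; last first.
    rewrite (dhomog_nemf_coeff hi); last by apply: contra bi => /eqP ->; rewrite subnK.
    rewrite big1 // => -[b' /= bi'] _; rewrite mcoeffZ mcoeffX; case: eqP => [e|_]; last by rewrite mulr0.
    by move: bi; rewrite -e (eqP bi') eqxx.
  have bd : (mdeg b < d.+1)%N by rewrite ltnS -bi leq_addr.
  have bi' : (mdeg (BMultinom bd) + a i == d)%N by apply/eqP.
  rewrite (bigD1 (exist _ (BMultinom bd) bi' : mono_shift d (a i))) //= mcoeffZ mcoeffX eqxx mulr1.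
  rewrite big1 ?addr0 // => t nt; rewrite mcoeffZ mcoeffX; case: eqP => [e|_]; last by rewrite mulr0.
  by case/eqP: nt; apply/val_inj/val_inj.
- move=> c c0 [i t]; have /ffunP/(_ i) := c0; rewrite lincomb_shifted_mono ffunE.
  move/(congr1 (mcoeff (val (val t)))); rewrite mcoeff0 raddf_sum (bigD1 t) //= mcoeffZ mcoeffX eqxx mulr1.
  rewrite big1 ?addr0 // => t' nt; rewrite mcoeffZ mcoeffX; case: eqP => [e|_]; last by rewrite mulr0.
  by case/eqP: nt; apply/val_inj/val_inj.
Qed.

End FormsBasis.

Lemma card_mono_shift n d a :
  #|{: mono_shift n.+1 d a}| = if (a <= d)%N then 'C(d - a + n, n) else 0%N.
Proof.
rewrite card_sub; case: ifP => [lead|/negbT nlead]; last first.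
  apply: eq_card0 => b; rewrite !inE; apply/negP => /eqP e.
  by move: nlead; rewrite -e leq_addl.
have -> : 'C(d - a + n, n) = 'C(d - a + n, d - a).
  by rewrite -bin_sub ?leq_addl // addnK.
rewrite -size_basis cardE -(size_map (@bmnm n.+1 d.+1)).
apply/perm_size/uniq_perm; rewrite ?uniq_basis //.
  by rewrite map_inj_uniq ?enum_uniq //; apply: val_inj.
move=> b; rewrite -basis_cover; apply/mapP/eqP => [[b' b'P ->]|bd].
  by move: b'P; rewrite mem_enum inE /= => /eqP e; rewrite -[LHS](addnK a) e.
have ltb : (mdeg b < d.+1)%N by rewrite bd ltnS leq_subr.
by exists (BMultinom ltb) => //; rewrite mem_enum inE /= bd subnK.
Qed.

(** Number of monomials of degree [d - a] in [n.+1] variables. *)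
Definition nmono n d a := if (a <= d)%N then 'C(d - a + n, n) else 0%N.

Section ResolutionMaps.
Variables (K : fieldType) (n m : nat).
Notation S := {mpoly K[n]}.

Definition eval_gens (f : 'I_m -> S) (u : {ffun 'I_m -> S}) : S := \sum_i u i * f i.

Lemma eval_gens_linear f : linear (eval_gens f).
Proof.
move=> c u v; rewrite /eval_gens scaler_sumr -big_split; apply: eq_bigr => i _.
by rewrite !ffunE mulrDl scalerAl.
Qed.

HB.instance Definition _ f := GRing.isLinear.Build K {ffun 'I_m -> S} S _
  (eval_gens f) (eval_gens_linear f).

Definition eval_syz q (z : 'I_q -> {ffun 'I_m -> S}) (c : {ffun 'I_q -> S}) : {ffun 'I_m -> S} :=
  vcomb z c.

Lemma eval_syz_linear q (z : 'I_q -> {ffun 'I_m -> S}) : linear (eval_syz z).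
Proof.
move=> c u v; apply/ffunP => i; rewrite !ffunE !vcombE scaler_sumr -big_split.
by apply: eq_bigr => j _; rewrite !ffunE mulrDl scalerAl.
Qed.

HB.instance Definition _ q z := GRing.isLinear.Build K {ffun 'I_q -> S} {ffun 'I_m -> S} _
  (eval_syz z) (@eval_syz_linear q z).

End ResolutionMaps.

Lemma card_shifted_mono n d r (e : 'I_r -> nat) :
  #|{: {i : 'I_r & mono_shift n.+1 d (e i)}}| = (\sum_i nmono n d (e i))%N.
Proof.
rewrite card_tagged sumnE big_map big_enum; apply: eq_bigr => i _.
  exact: card_mono_shift.
Qed.

Section HilbertFunction.
Variables (K : fieldType) (n : nat).
Notation S := {mpoly K[n.+1]}.
Variables (I : idealr S) (m q : nat) (f : 'I_m -> S) (z : 'I_q -> {ffun 'I_m -> S}).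
Variables (a : 'I_m -> nat) (b : 'I_q -> nat).
Hypothesis genI : hom_gens I f a.
Hypothesis genZ : homgen a (syzygies f) z b.
Hypothesis freeZ : forall c, vcomb z c = 0 -> forall j, c j = 0.

(** Exactness of the resolution in each degree. *)
Lemma eval_syz_image d :
  [set eval_syz z c | c in shifted_forms b d]%classic
  = [set u | shifted_forms a d u /\ eval_gens f u = 0]%classic.
Proof.
have [[Uz zP] hz] := genZ.
apply/seteqP; split=> u /=.
  move=> [c hc <-]; split; last first.
    have : syzygies f (vcomb z c) by apply: submodule_comb => //; apply: syzygies_submodule.
    by [].
  rewrite /eval_syz (_ : vcomb z c = vpart a d (vcomb z c)); first exact: vpart_homog.
  rewrite (vpart_comb _ _ hz); apply: eq_bigr => j _; congr vscale.
  by rewrite hpart_id.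
move=> [hu u0]; have [c uc] := zP _ u0.
exists [ffun j => hpart d (b j) (c j)].
  by move=> j; rewrite ffunE; apply: hpart_homog.
rewrite -[RHS](vpart_id hu) uc (vpart_comb _ _ hz); apply: eq_bigr => j _.
by rewrite ffunE.
Qed.

Lemma eval_gens_image d :
  [set eval_gens f u | u in shifted_forms a d]%classic = forms_in I d.
Proof.
have [fI fa fgen] := genI.
have fsh j : homog_shift (a j) 0 (f j) by rewrite /homog_shift leq0n subn0.
apply/seteqP; split=> p /=.
  move=> [u hu <-]; split; first by apply: rpred_sum => j _; apply/idealMr/fI.
  apply: rpred_sum => j _; move: (hu j); rewrite /homog_shift.
  case: ifP => [le_aj uj|_ /eqP ->]; last by rewrite mul0r rpred0.
  by rewrite -(subnK le_aj); apply: dhomogM => //; apply: fa.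
move=> [/fgen[c pc] hp]; exists [ffun j => hpart d (a j) (c j)].
  by move=> j; rewrite ffunE; apply: hpart_homog.
rewrite -[RHS](@hpart_id _ _ d 0); last by rewrite /homog_shift leq0n subn0.
rewrite pc hpart_sum; apply: eq_bigr => j _.
by rewrite ffunE (hpartMl _ _ (fsh j)).
Qed.

Lemma ideal_forms_basis d : exists2 k,
  exists w : 'I_k -> S, fbasis (forms_in I d) [set 0]%classic w &
  (k + \sum_j nmono n d (b j) = \sum_i nmono n d (a i))%N.
Proof.
have fker : fbasis [set c | shifted_forms b d c /\ eval_syz z c = 0]%classic [set 0]%classic
    (fun _ : void => 0 : {ffun 'I_q -> S}).
  split=> [[]//|c [_ c0]|c _ []//].
  exists (fun _ => 0); rewrite /lincomb big1 ?subr0 => [|[]//].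
  by apply/ffunP => j; rewrite ffunE; apply: freeZ.
have [k1 [w1 fw1] k1E] :=
  rank_nullity (@shifted_forms_sub K n.+1 q b d) (@shifted_forms_basis K n.+1 q b d) fker.
rewrite card_void addn0 card_shifted_mono in k1E.
rewrite eval_syz_image in fw1.
have [k [w fw] kE] := rank_nullity (@shifted_forms_sub K n.+1 m a d) (@shifted_forms_basis K n.+1 m a d) fw1.
rewrite eval_gens_image in fw; rewrite card_ord !card_shifted_mono k1E in kE.
by exists k => //; exists w.
Qed.

Lemma forms_basis d : exists w : 'I_(nmono n d 0) -> S, fbasis (@forms K n.+1 d) [set 0]%classic w.
Proof.
pose o := fun _ : 'I_1 => 0%N.
have fker : fbasis [set c | shifted_forms o d c /\ eval_gens (fun _ : 'I_1 => 1 : S) c = 0]%classic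
    [set 0]%classic (fun _ : void => 0 : {ffun 'I_1 -> S}).
  split=> [[]//|c [_ c0]|c _ []//].
  exists (fun _ => 0); rewrite /lincomb big1 ?subr0 => [|[]//].
  apply/ffunP => j; rewrite ffunE ord1; move: c0.
  by rewrite /eval_gens big_ord1 mulr1.
have [k [w fw]] := rank_nullity (@shifted_forms_sub K n.+1 1 o d) (@shifted_forms_basis K n.+1 1 o d) fker.
rewrite card_void addn0 card_shifted_mono big_ord1 => kE.
rewrite -kE; exists w; congr (fbasis _ _ w): fw.
apply/seteqP; split=> p /=.
  move=> [u hu <-]; rewrite /eval_gens big_ord1 mulr1; move: (hu ord0).
  by rewrite /homog_shift leq0n subn0.
move=> hp; exists [ffun=> p]; last by rewrite /eval_gens big_ord1 ffunE mulr1.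
by move=> j; rewrite ffunE /homog_shift leq0n subn0.
Qed.

Lemma forms_sub d : subspace (@forms K n.+1 d).
Proof.
split=> [|c x y xd yd]; first exact: dhomog0.
by apply: rpredD => //; apply: rpredZ.
Qed.

(** Additivity of dimension along the resolution. *)
Lemma hilbert_function_resolution d k (w : 'I_k -> S) :
  fbasis (@forms K n.+1 d) [set` I]%classic w ->
  (k + \sum_i nmono n d (a i) = nmono n d 0 + \sum_j nmono n d (b j))%N.
Proof.
move=> [wd sw iw]; have [k' [w' fw'] <-] := ideal_forms_basis d.
have [w0 fw0] := forms_basis d.
have fw : fbasis (@forms K n.+1 d) (forms_in I d) w.
  split=> // [p pd|c [/iw]] //.
  have [c Ic] := sw _ pd; exists c; split=> //.
  apply: (subspaceB (forms_sub d)) => //; apply: subspace_lincomb => //; exact: forms_sub.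
have sI : subspace (forms_in I d).
  split; first by split; [exact: idealr0|exact: dhomog0].
  move=> c x y [xI xd] [yI yd]; split; last exact: (forms_sub d).2.
  by rewrite /= -mul_mpolyC rpredD ?idealMr.
have fall := fbasis_cat (forms_sub d) sI _ _ fw fw'.
have := fbasis_card (zero_subspace _) (fall _ _) fw0.
rewrite card_sum !card_ord => <-; first by rewrite addnA.
- by move=> p ->; apply: subspace0.
- by move=> p [].
Qed.

Lemma exists_forms_basis d : exists k (w : 'I_k -> S), fbasis (@forms K n.+1 d) [set` I]%classic w.
Proof.
have [w0 fw0] := forms_basis d.
by apply: fbasis_quot fw0; apply/ideal_set_sub/idealr_set.
Qed.

(** As [I] is homogeneous, relations modulo [I] hold degree by degree, so that
    bases in the degrees below [T] can be put together. *)
Lemma cumulative_basis T (k : nat -> nat) (w : forall d, 'I_(k d) -> S) :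
  homogeneous_ideal I ->
  (forall d, fbasis (@forms K n.+1 d) [set` I]%classic (w d)) ->
  fbasis (deg_lt T) [set` I]%classic (fun t : {d : 'I_T & 'I_(k d)} => w (tag t) (tagged t)).
Proof.
move=> hI fw; have sI := ideal_set_sub (idealr_set I).
have lincE (c : {d : 'I_T & 'I_(k d)} -> K) :
    lincomb (fun t : {d : 'I_T & 'I_(k d)} => w (tag t) (tagged t)) c
    = \sum_(d < T) lincomb (w d) (fun i => c (existT (fun d : 'I_T => 'I_(k d)) d i)).
  by rewrite /lincomb (sig_big_dep _ (fun _ => xpredT)); apply: eq_bigr => -[].
split.
- move=> [[d ltd] i]; have [wd _ _] := fw d; rewrite /deg_lt /= msizeE.
  by apply/bigmax_leqP_seq => e es _; rewrite (dhomog_mf (wd i) es).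
- move=> p pT.
  have span (d : 'I_T) : exists c, pihomog mdeg d p - lincomb (w d) c \in I.
    by have [_ sw _] := fw d; apply: sw; apply: pihomogP.
  pose c d := projT1 (cid (span d)); have cP d := projT2 (cid (span d)).
  exists (fun t => c (tag t) (tagged t)); rewrite lincE.
  by rewrite {1}(pihomog_partitionE pT) -sumrB; apply: subspace_sum => // d _; apply: cP.
- move=> c; rewrite lincE => cI [d i].
  have [wd _ iw] := fw d; apply: (iw (fun i => c (existT (fun d : 'I_T => 'I_(k d)) d i))).
  have := hI _ d cI; rewrite linear_sum (bigD1 d) //= big1 ?addr0.
    rewrite pihomog_dE //; apply: (subspace_lincomb (forms_sub d)) => l; exact: wd.
  move=> e ne; apply: (@pihomog_ne0 _ _ _ e); first by rewrite (inj_eq val_inj).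
  by have [we _ _] := fw e; apply: (subspace_lincomb (forms_sub e)) => l; exact: we.
Qed.

End HilbertFunction.

(** * Moments of the degrees and multiplicity *)

Section BinomialPolynomials.

(** The polynomial [(X + 1) ... (X + k) / k!]. *)
Fixpoint binp k : {poly rat} :=
  if k is k'.+1 then (k%:R)^-1 *: (binp k' * ('X + (k%:R)%:P)) else 1.

Lemma binpE k (x : nat) : (binp k).[x%:R] = 'C(x + k, k)%:R.
Proof.
elim: k => [|k IH] /=; first by rewrite hornerC addn0 bin0.
rewrite hornerZ hornerM IH hornerD hornerX hornerC -natrD.
have k0 : k.+1%:R != 0 :> rat by rewrite pnatr_eq0.
apply: (mulfI k0); rewrite mulrA mulfV // mul1r -!natrM; congr _%:R.
by rewrite -mul_bin_diag addnS mulnC.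
Qed.

Lemma size_binp k : (size (binp k) <= k.+1)%N.
Proof.
elim: k => [|k IH] /=; first by rewrite size_poly1.
apply: leq_trans (size_scale_leq _ _) _; apply: leq_trans (size_polyMleq _ _) _.
by rewrite size_XaddC addn2 /=.
Qed.

Lemma coef_binp k : (binp k)`_k = (k`!%:R)^-1.
Proof.
elim: k => [|k IH] /=; first by rewrite coef1 invr1.
rewrite coefZ mulrDr coefD coefMX /= IH coefMC (nth_default _ (size_binp k)) mul0r addr0.
by rewrite factS natrM invfM.
Qed.

Lemma coef_XaddC_exp (y : rat) j l : (('X + y%:P) ^+ j)`_l = y ^+ (j - l) *+ 'C(j, l).
Proof.
elim: j l => [|j IH] l; first by rewrite coef1; case: l => [|l] //; rewrite bin0n.
rewrite exprSr mulrDr coefD coefMX coefMC; case: l => [|l] /=.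
  by rewrite add0r IH !subn0 !bin0 !mulr1n exprSr.
rewrite !IH subSS binS mulrnDr addrC; congr (_ + _).
have [ltlj|] := ltnP l j; last by move=> lejl; rewrite bin_small ?mulr0n ?mul0r.
by rewrite mulrnAl -exprSr subnSK.
Qed.

Lemma coef_comp_shift (p : {poly rat}) (c : rat) k l : (size p <= k)%N ->
  (p \Po ('X - c%:P))`_l = \sum_(j < k) p`_j * ((- c) ^+ (j - l) *+ 'C(j, l)).
Proof.
move=> lek; rewrite comp_polyE coef_sum.
rewrite (big_ord_widen k (fun j => (p`_j *: ('X - c%:P) ^+ j)`_l)) //.
rewrite big_mkcond; apply: eq_bigr => j _; rewrite -polyCN.
case: ifP => [_|/negbT]; first by rewrite coefZ coef_XaddC_exp.
by rewrite -leqNgt => sz; rewrite nth_default // mul0r.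
Qed.

Variables (m q : nat) (a : 'I_m -> nat) (b : 'I_q -> nat).

Definition hilb_poly k : {poly rat} := binp k
  - \sum_i (binp k \Po ('X - (a i)%:R%:P)) + \sum_j (binp k \Po ('X - (b j)%:R%:P)).

(** Power sums of the degrees in the resolution of [S/I], with the signs of the
    Euler characteristic; the first term belongs to [S], in degree 0, and is 1 or
    0 according as [r] is 0 or not. *)
Definition moment r : rat :=
  0%:R ^+ r - \sum_i (a i)%:R ^+ r + \sum_j (b j)%:R ^+ r.

(** Expanding the shifts of [binp k] by the binomial formula, the degrees only
    enter through their power sums. *)
Lemma coef_hilb_poly k l : (hilb_poly k)`_l =
  \sum_(j < k.+1) (binp k)`_j * ((-1) ^+ (j - l) * moment (j - l) *+ 'C(j, l)).
Proof.
pose T c := \sum_(j < k.+1) (binp k)`_j * ((-1) ^+ (j - l) * c%:R ^+ (j - l) *+ 'C(j, l)).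
have TE c : (binp k \Po ('X - (c%:R)%:P))`_l = T c.
  rewrite (coef_comp_shift _ _ (size_binp k)); apply: eq_bigr => j _.
  by rewrite -exprMn mulN1r.
transitivity (T 0%N - \sum_i T (a i) + \sum_j T (b j)).
  rewrite /hilb_poly coefD coefB !coef_sum; congr (_ - _ + _).
  - by rewrite -TE subr0 comp_polyXr.
  - by apply: eq_bigr => i _; apply: TE.
  - by apply: eq_bigr => i _; apply: TE.
rewrite /T [X in _ - X + _]exchange_big [X in _ + X]exchange_big /= -sumrB -big_split.
apply: eq_bigr => j _ /=; rewrite -!mulr_sumr -mulrBr -mulrDr; congr (_ * _).
rewrite !sumrMnl -mulrnBl -mulrnDl; congr (_ *+ _).
by rewrite /moment mulrDr mulrBr !mulr_sumr.
Qed.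

Lemma hilb_poly_coef0 k : (hilb_poly k)`_k = moment 0 * (k`!%:R)^-1.
Proof.
rewrite coef_hilb_poly big_ord_recr /= subnn binn mulr1n expr0 mul1r coef_binp.
rewrite big1 ?add0r 1?mulrC // => j _.
by rewrite bin_small ?mulr0n ?mulr0.
Qed.

Lemma hilb_poly_coef1 k : moment 0 = 0 ->
  (hilb_poly k.+1)`_k = - moment 1 * ((k`!)%:R)^-1.
Proof.
move=> m0; rewrite coef_hilb_poly.
move: (binp k.+1) (coef_binp k.+1) => B BE.
rewrite !big_ord_recr big1 /= ?add0r; last first.
  by move=> j _; rewrite bin_small ?mulr0n ?mulr0.
rewrite subnn m0 mulr0 mul0rn mulr0 add0r subSnn expr1 BE binSn mulN1r factS natrM invfM.
have k0 : k.+1%:R != 0 :> rat by rewrite pnatr_eq0.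
rewrite -[(- _) *+ _]mulr_natr; move: (_ `!%:R^-1) => v; move: k0; move: (k.+1%:R) => u u0.
by field.
Qed.

Lemma hilb_poly_coef2 k : moment 0 = 0 -> moment 1 = 0 ->
  (hilb_poly k.+2)`_k = moment 2 / 2 * ((k`!)%:R)^-1.
Proof.
move=> m0 m1; rewrite coef_hilb_poly.
move: (binp k.+2) (coef_binp k.+2) => B BE.
rewrite !big_ord_recr big1 /= ?add0r; last first.
  by move=> j _; rewrite bin_small ?mulr0n ?mulr0.
rewrite subnn subSnn (_ : k.+2 - k = 2)%N; last by lia.
rewrite m0 m1 !mulr0 !mul0rn !mulr0 !add0r BE sqrrN expr1n mul1r.
have k0 : (k`!)%:R != 0 :> rat by rewrite pnatr_eq0 -lt0n fact_gt0.
have binE : 'C(k.+2, k)%:R * 2 = (k.+2 * k.+1)%:R :> rat.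
  rewrite -natrM; congr _%:R.
  have := @bin_sub k.+2 2 isT; rewrite !subSS subn0 => ->.
  by have := mul_bin_diag k.+2 1; rewrite bin1 /= => ->; rewrite mulnC.
rewrite !factS !natrM -[moment 2 *+ _]mulr_natr.
have k1 : k.+1%:R != 0 :> rat by rewrite pnatr_eq0.
have k2 : k.+2%:R != 0 :> rat by rewrite pnatr_eq0.
move: binE; rewrite natrM; move: ('C(_, _)%:R) => c cE.
have -> : c = k.+2%:R * k.+1%:R / 2 by rewrite -cE mulfK.
move: k0 k1 k2; move: (k`!%:R) (k.+1%:R) (k.+2%:R) => u v w u0 v0 w0.
by field; rewrite u0 v0 w0.
Qed.

Lemma hilb_polyE k d : (forall i, (a i <= d)%N) -> (forall j, (b j <= d)%N) ->
  (hilb_poly k).[d%:R]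
  = (nmono k d 0)%:R - (\sum_i nmono k d (a i))%:R + (\sum_j nmono k d (b j))%:R.
Proof.
move=> ad bd.
have shiftE c : (c <= d)%N -> (binp k \Po ('X - (c%:R)%:P)).[d%:R] = (nmono k d c)%:R.
  by move=> cd; rewrite horner_comp hornerXsubC -natrB // binpE /nmono cd.
rewrite /hilb_poly 2!hornerD hornerN !horner_sum !natr_sum; congr (_ - _ + _).
- by rewrite binpE /nmono leq0n subn0.
- by apply: eq_bigr => i _; apply: shiftE.
- by apply: eq_bigr => j _; apply: shiftE.
Qed.

End BinomialPolynomials.

Lemma sum_nmono n T c : (\sum_(d < T.+1) nmono n d c)%N = nmono n.+1 T c.
Proof.
elim: T => [|T IH]; first by rewrite big_ord1 /nmono leqn0; case: eqP => // ->; rewrite !binn.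
rewrite big_ord_recr /= IH /nmono; case: (ltngtP c T.+1) => [|lt|->].
- rewrite ltnS => leT; rewrite leT subSn //.
  by rewrite [in RHS]addSn binS addSnnS.
- by rewrite leqNgt (ltnW lt).
- by rewrite ltnn subnn !add0n !binn.
Qed.

Section PolynomialGrowth.
Variable p : {poly rat}.

(** For large [t] the leading term is at least twice the sum of the others. *)
Lemma poly_growth r : p`_r != 0 -> exists C N : nat, forall t : nat, (N <= t)%N ->
  t%:R ^+ r <= C%:R * `|p.[t%:R]|.
Proof.
move=> pr; have p0 : p != 0 by apply: contraNneq pr => ->; rewrite coef0.
set k := (size p).-1; have szp : size p = k.+1 by rewrite /k prednK // lt0n size_poly_eq0.
have lerk : (r <= k)%N.
  by rewrite -ltnS -szp ltnNge; apply: contra pr => h; rewrite nth_default.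
pose l := `|p`_k|; have l0 : 0 < l by rewrite normr_gt0 -[p`_k]/(lead_coef p) lead_coef_eq0.
pose A := \sum_(i < k) `|p`_i|.
have A0 : 0 <= A by apply: sumr_ge0.
exists (Num.bound (2 / l)), (maxn 1 (Num.bound (2 * A / l))) => t.
rewrite geq_max => /andP[t1 tA].
have t1' : 1 <= t%:R :> rat by rewrite ler1n.
have t0 : 0 < t%:R :> rat by rewrite ltr0n.
have tA' : 2 * A <= l * t%:R.
  rewrite [leRHS]mulrC -ler_pdivrMr //.
  apply: le_trans (ltW (archi_boundP _)) _; first by rewrite divr_ge0 ?mulr_ge0 // ltW.
  by rewrite ler_nat.
have tail : t%:R * `|\sum_(i < k) p`_i * t%:R ^+ i| <= A * t%:R ^+ k.
  rewrite -{1}[t%:R]ger0_norm ?ler0n // -normrM mulr_sumr.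
  apply: le_trans (ler_norm_sum _ _ _) _; rewrite mulr_suml; apply: ler_sum => i _.
  rewrite mulrCA -exprS normrM ler_wpM2l // ger0_norm ?exprn_ge0 ?ler0n //.
  by rewrite ler_weXn2l.
have main : l * t%:R ^+ k <= 2 * `|p.[t%:R]|.
  rewrite -(ler_pM2r t0).
  have pE : p.[t%:R] = \sum_(i < k) p`_i * t%:R ^+ i + p`_k * t%:R ^+ k.
    by rewrite horner_coef szp big_ord_recr.
  have : l * t%:R ^+ k <= `|p.[t%:R]| + `|\sum_(i < k) p`_i * t%:R ^+ i|.
    rewrite /l -[X in _ * X]ger0_norm ?exprn_ge0 ?ler0n // -normrM.
    have -> : p`_k * t%:R ^+ k = p.[t%:R] - \sum_(i < k) p`_i * t%:R ^+ i by rewrite pE addrC addKr.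
    exact: ler_normB.
  have tk : 0 <= t%:R ^+ k :> rat by rewrite exprn_ge0 ?ler0n.
  move: tail tA' tk; move: (t%:R ^+ k) (`|p.[_]|) (`|\sum_(i < k) _|) => w u v.
  move=> h1 h2 w0 h3.
  have h4 : 2 * A * w <= l * t%:R * w by apply: ler_wpM2r.
  have h5 : (l * w) * t%:R <= (u + v) * t%:R by apply: ler_wpM2r => //; apply: ltW.
  by lra.
apply: le_trans (_ : t%:R ^+ k <= _); first by rewrite ler_weXn2l.
have : t%:R ^+ k <= 2 / l * `|p.[t%:R]|.
  by rewrite -mulrA [_^-1 * _]mulrC mulrA ler_pdivlMr // mulrC.
move=> h; apply: le_trans h _; apply: ler_wpM2r => //; apply/ltW/archi_boundP.
by rewrite divr_ge0 // ltW.
Qed.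

End PolynomialGrowth.

Lemma poly_eq_large (p r : {poly rat}) N :
  (forall t : nat, (N <= t)%N -> p.[t%:R] = r.[t%:R]) -> p = r.
Proof.
move=> pr; apply/eqP; rewrite -subr_eq0; apply: contraT => d0.
have l0 : lead_coef (p - r) != 0 by rewrite lead_coef_eq0.
have [C [N' h]] := poly_growth l0; pose t := (maxn N N').+1.
have := h t (leq_trans (leq_maxr _ _) (leqnSn _)).
rewrite hornerD hornerN pr ?subrr ?normr0 ?mulr0; last exact: leq_trans (leq_maxl _ _) (leqnSn _).
by rewrite leNgt exprn_gt0 ?ltr0n.
Qed.

Section Multiplicity.
Variables (K : fieldType) (n : nat).
Notation S := {mpoly K[n.+1]}.
Variables (I : idealr S) (m q : nat) (f : 'I_m -> S) (z : 'I_q -> {ffun 'I_m -> S}).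
Variables (a : 'I_m -> nat) (b : 'I_q -> nat).
Hypothesis homI : homogeneous_ideal I.
Hypothesis genI : hom_gens I f a.
Hypothesis genZ : homgen a (syzygies f) z b.
Hypothesis freeZ : forall c, vcomb z c = 0 -> forall j, c j = 0.

Let D := (\max_i a i + \max_j b j)%N.

Let aD i : (a i <= D)%N.
Proof. by rewrite /D (bigD1 i) //=; apply: leq_trans (leq_maxl _ _) (leq_addr _ _). Qed.

Let bD j : (b j <= D)%N.
Proof. by rewrite /D addnC (bigD1 j) //=; apply: leq_trans (leq_maxl _ _) (leq_addr _ _). Qed.

Lemma forms_basis_size d k (w : 'I_k -> S) : (D <= d)%N ->
  fbasis (@forms K n.+1 d) [set` I]%classic w -> k%:R = (hilb_poly a b n).[d%:R].
Proof.
move=> leDd /(hilbert_function_resolution genI genZ freeZ) /(congr1 (fun x => x%:R : rat)).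
rewrite !natrD hilb_polyE => [/eqP||] //; try by move=> ?; apply: leq_trans leDd.
by rewrite eq_sym -subr_eq => /eqP <-; rewrite addrAC.
Qed.

Lemma deg_lt_basis_size T : (D <= T)%N ->
  exists k (w : 'I_k -> S), fbasis (deg_lt T.+1) [set` I]%classic w /\
    k%:R = (hilb_poly a b n.+1).[T%:R].
Proof.
move=> leDT; have ex := @exists_forms_basis K n I.
pose k d := projT1 (cid (ex d)).
pose w d : 'I_(k d) -> S := projT1 (cid (projT2 (cid (ex d)))).
have wP d : fbasis (@forms K n.+1 d) [set` I]%classic (w d) := projT2 (cid (projT2 (cid (ex d)))).
have fw := cumulative_basis T.+1 homI wP.
exists #|{: {d : 'I_T.+1 & 'I_(k d)}}|.
exists ((fun t : {d : 'I_T.+1 & 'I_(k d)} => w (tag t) (tagged t)) \o enum_val); split.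
  exact: (fbasis_bij (@enum_val_bij {d : 'I_T.+1 & 'I_(k d)}) fw).
have -> : #|{: {d : 'I_T.+1 & 'I_(k d)}}| = (\sum_(d < T.+1) k d)%N.
  by rewrite card_tagged sumnE big_map big_enum; apply: eq_bigr => d _; apply: card_ord.
have eq_k d := hilbert_function_resolution genI genZ freeZ (wP d).
have /(congr1 (fun x => x%:R : rat)) : (\sum_(d < T.+1) k d + \sum_i nmono n.+1 T (a i)
    = nmono n.+1 T 0 + \sum_j nmono n.+1 T (b j))%N.
  under [X in (_ + X = _)%N]eq_bigr do rewrite -sum_nmono.
  under [X in (_ = _ + X)%N]eq_bigr do rewrite -sum_nmono.
  rewrite -sum_nmono exchange_big [X in (_ = _ + X)%N]exchange_big -!big_split /=.
  by apply: eq_bigr => d _; apply: eq_k.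
rewrite !natrD hilb_polyE => [/eqP||] //; try by move=> ?; apply: leq_trans leDT.
by rewrite eq_sym -subr_eq => /eqP <-; rewrite addrAC.
Qed.

Lemma coef_growth r : (hilb_poly a b n.+1)`_r != 0 -> growth [set` I]%classic r.
Proof.
move=> /poly_growth[C [N CN]]; exists (C * 2 ^ r)%N => N'.
pose t := (maxn (maxn N N') D).+1.
have ltNt : (N <= t)%N by apply: leqW; rewrite !leq_max leqnn.
have ltN't : (N' <= t.+1)%N.
  by do 2!apply: leqW; rewrite !leq_max leqnn orbT.
have leDt : (D <= t)%N by apply: leqW; rewrite !leq_max leqnn orbT.
exists t.+1 => //; have [k [w [[wt _ iw] kE]]] := deg_lt_basis_size leDt.
exists k, w; split=> //.
have := CN t ltNt; rewrite -kE ger0_norm ?ler0n // -natrX -natrM ler_nat => le_t.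
apply: leq_trans (_ : (2 * t) ^ r <= _)%N.
  by case: (r) => [|r'] //; rewrite leq_exp2r // mul2n -addnn -addn1 leq_add2l.
by rewrite expnMn mulnC mulnAC leq_mul2r le_t orbT.
Qed.

Lemma growth_proper : growth [set` I]%classic 0.
Proof. by apply: growth0; [apply: idealr_set|rewrite /= idealr1]. Qed.

Hypothesis htI : ideal_height I 2.

(** A nonzero coefficient of [hilb_poly a b n.+1] in degree [n] or [n.+1] would
    give [S/I] a growth that is not compatible with height two. *)
Lemma moments_eq0 : moment a b 0 = 0 /\ moment a b 1 = 0.
Proof.
have small r : (n <= r)%N -> (hilb_poly a b n.+1)`_r = 0.
  move=> lenr; apply: contrapT => /eqP/coef_growth/(growth_ideal_height homI htI).
  by rewrite add2n ltnS => lt; have := leq_ltn_trans lenr lt; rewrite ltnn.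
have m0 : moment a b 0 = 0.
  have := small n.+1 (leqnSn n); rewrite hilb_poly_coef0 => /eqP.
  by rewrite mulf_eq0 invr_eq0 pnatr_eq0 (gtn_eqF (fact_gt0 _)) orbF => /eqP.
split=> //; have := small n (leqnn n); rewrite hilb_poly_coef1 // => /eqP.
by rewrite mulf_eq0 invr_eq0 pnatr_eq0 (gtn_eqF (fact_gt0 _)) orbF oppr_eq0 => /eqP.
Qed.

(** Both the Krull dimension and the multiplicity are read off the Hilbert
    polynomial, whose two top coefficients vanish because of the height. *)
Lemma multiplicity_moment e : moment a b 2 != 0 -> multiplicity I e -> e = moment a b 2 / 2.
Proof.
move=> m2 [d dimI mulI]; have [m0 m1] := moments_eq0.
have := growth_ideal_height homI htI growth_proper; rewrite addn0.
case nE: n => [//|n'] _.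
have c2 : (hilb_poly a b n.+1)`_n' != 0.
  rewrite nE hilb_poly_coef2 // !mulf_neq0 ?invr_eq0 ?pnatr_eq0 //.
  by rewrite -lt0n fact_gt0.
(* The next coefficient does not vanish, which determines the dimension. *)
have le_d := le_krull_dim homI (coef_growth c2) dimI.
have := krull_dim_le htI dimI; rewrite nE add2n !ltnS => ge_d.
have {le_d ge_d} dE : d = n' by apply/eqP; rewrite eqn_leq ge_d.
case: d dE dimI mulI => [|k] dE _.
  (* In dimension 0, a basis of [S/I] has bounded degree. *)
  move=> [s sb ->].
  have fs := basis_mod_fbasis sb.
  pose T := (D + \max_(i < size s) msize s`_i)%N.
  have [l [w [fw lE]]] := deg_lt_basis_size (leq_addr _ _ : D <= T)%N.
  have fs' : fbasis (deg_lt T.+1) [set` I]%classic (fun i : 'I_(size s) => s`_i).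
    have [_ ss si] := fs; split=> // [i|v _]; last exact: ss.
    rewrite /deg_lt /= /T (bigD1 i) //= leqW // (leq_trans _ (leq_addl _ _)) //.
    by rewrite leq_maxl.
  have := fbasis_card (ideal_set_sub (idealr_set I)) fs' fw; rewrite !card_ord => ->.
  rewrite lE nE -dE; have -> : hilb_poly a b 2 = ((hilb_poly a b 2)`_0)%:P.
    apply/polyP => -[|[|[|i]]]; rewrite coefC //=.
    - by rewrite hilb_poly_coef1 // m1 oppr0 mul0r.
    - by rewrite hilb_poly_coef0 m0 mul0r.
    - rewrite coef_hilb_poly big1 // => j _; rewrite bin_small ?mulr0n ?mulr0 //.
      by apply: leq_trans (ltn_ord j) _.
  by rewrite hornerC hilb_poly_coef2 // fact0 invr1 mulr1.
move=> [P [N PN] ->].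
have -> : P = hilb_poly a b n.
  apply: (@poly_eq_large _ _ (maxn N D)) => t; rewrite geq_max => /andP[Nt Dt].
  have [h [s sb ->] ->] := PN t Nt.
  exact: forms_basis_size Dt (basis_mod_fbasis sb).
rewrite nE -dE hilb_poly_coef2 //.
by rewrite mulrC mulfVK // pnatr_eq0 -lt0n fact_gt0.
Qed.

End Multiplicity.

(** * Generators of a power of the irrelevant ideal *)

Section FormsNeeded.
Variables (K : fieldType) (n : nat).
Notation S := {mpoly K[n]}.

(** The monomials with exponents less than [t] have degree less than a fixed
    multiple of [t], and there are [t ^ n] of them. *)
Lemma growth_polynomial_ring : growth [set 0 : S]%classic n.
Proof.
exists (n.+1 ^ n)%N => N; pose t := N.+1.
exists (n.+1 * t)%N; first by rewrite mulSn (leq_trans (leqnSn _)) ?leq_addr.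
pose e2m (e : {ffun 'I_n -> 'I_t}) := [multinom (e i : nat) | i < n].
have e2m_inj : injective e2m.
  move=> e e' /mnmP h; apply/ffunP => i; apply: val_inj.
  by have := h i; rewrite !mnmE.
apply: (@growth_fin _ _ _ (fun e => 'X_[e2m e])).
- move=> e; rewrite /deg_lt /= msizeX mdegE mulSn -addn1 addnC leq_add //.
  rewrite -[n in leqRHS]card_ord -sum_nat_const; apply: leq_sum => i _.
  by rewrite mnmE ltnW.
- move=> c /= c0 e; have := congr1 (mcoeff (e2m e)) c0.
  rewrite mcoeff0 raddf_sum (bigD1 e) //= mcoeffZ mcoeffX eqxx mulr1 big1 ?addr0 // => e' ne.
  by rewrite mcoeffZ mcoeffX (inj_eq e2m_inj) (negPf ne) mulr0.
- by rewrite card_ffun !card_ord expnMn.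
Qed.

Definition ideal_of_seq (s : seq S) : set S :=
  foldr (fun g J => ideal_add J g) [set 0]%classic s.

Lemma zero_ideal : ideal_set [set 0 : S]%classic.
Proof. by split=> // c x y -> ->; rewrite mulr0 addr0. Qed.

Lemma ideal_of_seq_ideal s : ideal_set (ideal_of_seq s).
Proof. by elim: s => [|g s IH]; [exact: zero_ideal|exact: ideal_add_ideal]. Qed.

Lemma mem_ideal_of_seq s g : g \in s -> ideal_of_seq s g.
Proof.
elim: s => // h s IH; rewrite inE => /orP[/eqP ->|/IH] /=.
  exact/ideal_add_mem/ideal_of_seq_ideal.
exact: ideal_add_sub.
Qed.

Lemma growth_ideal_of_seq s :
  {in s, forall g, exists2 e, (0 < e)%N & g \is e.-homog} -> (size s <= n)%N ->
  homogeneous_set (ideal_of_seq s) /\ growth (ideal_of_seq s) (n - size s).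
Proof.
elim: s => [|g s IH] hs /= les.
  split; first by move=> p d /= ->; rewrite pihomog0.
  by rewrite subn0; apply: growth_polynomial_ring.
have [e e0 ge] := hs g (mem_head _ _).
have [|hI gI] := IH _ (ltnW les); first by move=> h hI; apply: hs; rewrite inE hI orbT.
split; first exact: ideal_add_homogeneous ge hI.
by apply: (growth_form (ideal_of_seq_ideal s) hI e0 ge); rewrite subnSK.
Qed.

(** Each form lowers the growth by at most one, and the growth of the whole ring
    is [n], while a power of the irrelevant ideal leaves a quotient of finite
    dimension. *)
Lemma irrelevant_power_generators s t :
  {in s, forall g, exists2 e, (0 < e)%N & g \is e.-homog} ->
  (forall b : 'X_{1..n}, mdeg b = t -> ideal_of_seq s 'X_[b]) -> (n <= size s)%N.
Proof.
move=> hs sX; rewrite leqNgt; apply/negP => lts.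
have [_ [C CP]] := growth_ideal_of_seq hs (ltnW lts).
have idJ := ideal_of_seq_ideal s; have sJ := ideal_set_sub idJ.
have [u ltu [k [w [wt iw le_u]]]] := CP (C * t ^ n).+1.
have up b : (t <= mdeg b)%N -> ideal_of_seq s 'X_[b].
  elim: {b}(mdeg b) {-2}b (erefl (mdeg b)) => [|d IH] b bd.
    by rewrite bd leqn0 => /eqP t0; apply: sX; rewrite bd t0.
  rewrite bd leq_eqVlt => /orP[/eqP td|ltd]; first by apply: sX; rewrite bd td.
  have [i bi] : exists i, (U_(i) <= b)%MM.
    have : mdeg b != 0%N by rewrite bd.
    rewrite mdegE; apply: contraNP => nex; apply/eqP/big1 => i _; apply/eqP.
    by apply: contraT => bi; case: nex; exists i; rewrite lep1mP.
  have bd' : mdeg (b - U_(i))%MM = d.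
    by have := mdegD (b - U_(i)) U_(i); rewrite submK // mdeg1 bd; lia.
  rewrite -(submK bi) addmC mpolyXD; apply: ideal_setM => //; apply: IH => //.
  by rewrite bd'.
have spanw (p : S) : spanmod (ideal_of_seq s)
    (fun e : {ffun 'I_n -> 'I_t} => 'X_[[multinom (e i : nat) | i < n]]) p.
  rewrite [p]mpolyE; apply: (subspace_sum (spanmod_sub sJ _)) => b _.
  apply: subspaceZ; first exact: spanmod_sub.
  have [/up Xb|ltb] := leqP t (mdeg b); first exact: spanmod_mod.
  apply: (spanmod_monomials sJ); rewrite /deg_lt /= msizeX.
  exact: ltb.
have := indep_leq sJ iw (fun i => spanw (w i)); rewrite card_ffun !card_ord => le_k.
have : (u <= u ^ (n - size s))%N.
  rewrite -{1}[u]expn1 leq_pexp2l ?subn_gt0 //; exact: leq_ltn_trans ltu.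
move=> h; have := leq_trans h le_u; rewrite leqNgt => /negP; apply.
by apply: leq_ltn_trans ltu; rewrite leq_mul2l le_k orbT.
Qed.

End FormsNeeded.

(** * Degrees of generators and syzygies *)

Section DegreeMatrix.
Variables (K : fieldType) (n : nat).
Notation S := {mpoly K[n]}.
Variables (I : idealr S) (m q : nat) (f : 'I_m -> S) (z : 'I_q -> {ffun 'I_m -> S}).
Variables (a : 'I_m -> nat) (b : 'I_q -> nat).
Hypothesis minf : min_gens I f a.
Hypothesis genZ : homgen a (syzygies f) z b.
Hypothesis freeZ : forall c, vcomb z c = 0 -> forall j, c j = 0.

Lemma syzygies_graded : graded a (syzygies f).
Proof.
have [[_ fa _] _] := minf.
move=> u d u0; rewrite /syzygies /= -[RHS](hpart0 K n d 0) -[in RHS]u0 hpart_sum.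
apply: eq_bigr => i _; rewrite ffunE (hpartMl d (e := a i)) //.
by rewrite /homog_shift leq0n subn0.
Qed.

(** The entry has degree [b j - a i]; if this is 0 it is a constant, which
    vanishes because the generators are minimal. *)
Lemma syzygy_entry_eq0 j i : (b j <= a i)%N -> z j i = 0.
Proof.
have [[Uz _] hz] := genZ; move=> le_ba.
have := hz j i; rewrite /homog_shift; case: ifP => [le_ab|_ /eqP //].
have -> : (b j - a i = 0)%N by apply/eqP; rewrite subn_eq0.
move=> h0; have c0 := min_gens_rel minf (Uz j) i.
apply/mpolyP => e; rewrite mcoeff0.
have [->|ne] := eqVneq e 0%MM; first by [].
by apply: (dhomog_nemf_coeff h0); rewrite mdeg_eq0.
Qed.

(** The syzygies of degree at most [v] only involve generators of degree less
    than [v]; being independent relations among nonzero elements, they are fewer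
    than these generators. *)
Lemma card_syzygies_lt v : (0 < #|[pred j | b j <= v]%N|)%N ->
  (#|[pred j | (b j <= v)%N]| < #|[pred i | (a i < v)%N]|)%N.
Proof.
move=> J0; rewrite ltnNge; apply/negP => leRJ.
have [[Uz _] _] := genZ.
set R := [pred i | _] in leRJ; set J := [pred j | _] in leRJ J0.
have entry0 j i : j \in J -> i \notin R -> z j i = 0.
  rewrite !inE -leqNgt => bj ai; apply: syzygy_entry_eq0; exact: leq_trans bj ai.
have [R0|R0] := posnP #|R|.
  have j0 := enum_valP (Ordinal J0); set j := enum_val _ in j0.
  have rel : vcomb z (fun k => (k == j)%:R) = 0.
    apply/ffunP => i; rewrite vcombE ffunE (bigD1 j) //= eqxx mul1r entry0 //.
      by rewrite add0r big1 // => k /negPf ->; rewrite mul0r.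
    by rewrite (card0_eq R0).
  by have /eqP := freeZ rel j; rewrite eqxx oner_eq0.
pose col (k : 'I_#|R|) := enum_val (widen_ord leRJ k).
pose M : 'M[S]_#|R| := \matrix_(k, l) z (col k) (enum_val l).
pose F : 'cV[S]_#|R| := \col_l f (enum_val l).
have MF : M *m F = 0.
  apply/colP => k; rewrite !mxE.
  transitivity (\sum_(i in R) z (col k) i * f i).
    by rewrite [RHS]big_enum_val; apply: eq_bigr => l _; rewrite !mxE.
  have := Uz (col k); rewrite /syzygies /= (bigID (mem R)) /= [X in _ + X]big1 ?addr0 //.
  by move=> i iR; rewrite entry0 ?mul0r //; apply: enum_valP.
have det0 : \det M = 0.
  have : \det M *: F = 0 by rewrite -mul_scalar_mx -mul_adj_mx -mulmxA MF mulmx0.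
  move=> /colP/(_ (Ordinal R0)); rewrite !mxE => /eqP; rewrite mulf_eq0.
  by rewrite (negPf (min_gens_neq0 minf _)) orbF => /eqP.
have /det0P[w w0 wM] : \det M == 0 by rewrite det0.
case/eqP: w0; apply/rowP => k; rewrite mxE.
have col_inj : injective col by move=> x y /enum_val_inj e; apply: val_inj; apply: (congr1 val e).
pose c j := \sum_(l | col l == j) w 0 l.
have -> : w 0 k = c (col k).
  by rewrite /c (bigD1 k) //= big1 ?addr0 // => l /andP[/eqP/col_inj ->]; rewrite eqxx.
apply: freeZ; apply/ffunP => i; rewrite vcombE ffunE.
have -> : \sum_j c j * z j i = \sum_l w 0 l * z (col l) i.
  rewrite /c; under eq_bigr do rewrite mulr_suml.
  rewrite (exchange_big_dep xpredT) //=; apply: eq_bigr => l _.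
  by rewrite (big_pred1 (col l)) // => j; apply: eq_sym.
have [iR|iR] := boolP (i \in R); last first.
  by rewrite big1 // => l _; rewrite entry0 ?mulr0 //; apply: enum_valP.
transitivity ((w *m M) 0 (enum_rank_in iR i)); last by rewrite wM mxE.
by rewrite mxE; apply: eq_bigr => l _; rewrite mxE enum_rankK_in.
Qed.

(** Multiples of [f i] in the ideal of the other generators are measured by
    the [i]-th entries of the syzygies; those entries vanish unless the syzygy
    has larger degree than [f i]. *)
Lemma inessential_card i : inessential (gens_seq f) (f i) ->
  (n <= #|[pred j | (a i < b j)%N]|)%N.
Proof.
move=> /inessentialP[t tP].
pose s := [seq z j i | j <- enum [pred j | (a i < b j)%N]].
have -> : #|[pred j | (a i < b j)%N]| = size s by rewrite size_map cardE.
have [[Uz zP] hz] := genZ.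
apply: (@irrelevant_power_generators _ _ s t).
  move=> _ /mapP[j + ->]; rewrite mem_enum inE => lt_ab.
  exists (b j - a i)%N; first by rewrite subn_gt0.
  by have := hz j i; rewrite /homog_shift (ltnW lt_ab).
move=> e /tP[c ce ci].
have [|d dE] := zP [ffun k => (if k == i then 'X_[e] else 0) - c k].
  rewrite /syzygies /=; under eq_bigr do rewrite ffunE mulrBl.
  rewrite sumrB -ce (bigD1 i) //= eqxx big1 ?addr0; first by rewrite mulrC subrr.
  by move=> k /negPf ->; rewrite mul0r.
have /ffunP/(_ i) := dE; rewrite ffunE eqxx ci subr0 vcombE => ->.
apply: (big_ind (ideal_of_seq s)).
- exact: (ideal_set0 (ideal_of_seq_ideal s)).
- exact: (ideal_setD (ideal_of_seq_ideal s)).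
move=> j _; have [lt_ab|le_ba] := ltnP (a i) (b j).
  apply: ideal_setM; first exact: ideal_of_seq_ideal.
  by apply: mem_ideal_of_seq; apply: map_f; rewrite mem_enum.
by rewrite syzygy_entry_eq0 // mulr0; apply: (ideal_set0 (ideal_of_seq_ideal s)).
Qed.

End DegreeMatrix.

(** * The numerical estimate *)

Section Numerics.

Lemma sorted_count_lt (s : seq nat) v k :
  sorted leq s -> (k < count (fun x => x < v) s)%N -> (nth 0%N s k < v)%N.
Proof.
move=> ss kc; rewrite ltnNge; apply/negP => le_v; move: kc; rewrite ltnNge => /negP; apply.
have [ks|sk] := ltnP k (size s); last first.
  exact: leq_trans (count_size _ _) sk.
rewrite -[s in X in (X <= _)%N](cat_take_drop k) count_cat.
rewrite [X in (_ + X)%N](_ : _ = 0%N); last first.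
  apply/eqP; rewrite -leqn0 leqNgt -has_count; apply/hasPn => x /(nthP 0%N)[i].
  rewrite size_drop nth_drop => i_lt <-; rewrite -leqNgt; apply: leq_trans le_v _.
  have := sorted_leq_nth leq_trans leqnn 0%N ss; apply; rewrite ?inE ?leq_addr //.
  by rewrite -ltn_subRL.
by rewrite addn0 (leq_trans (count_size _ _)) // size_take ks.
Qed.

Lemma sorted_count_le (s : seq nat) k :
  sorted leq s -> (k < size s)%N -> (k < count (fun x => x <= nth 0%N s k) s)%N.
Proof.
move=> ss ks; set v := nth 0%N s k; rewrite -[s in X in (_ < X)%N](cat_take_drop k.+1) count_cat.
apply: leq_trans (leq_addr _ _); rewrite [X in (_ < X)%N](_ : _ = k.+1) //.
have sz : size (take k.+1 s) = k.+1 by rewrite size_takel.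
rewrite -[RHS]sz; apply/eqP; rewrite -all_count; apply/(all_nthP 0%N) => i.
rewrite sz => ik; rewrite nth_take //=.
by apply: (sorted_leq_nth leq_trans leqnn 0%N ss); rewrite ?inE //; apply: leq_trans ik ks.
Qed.

(** For [l <= x < y], the difference [y ^ 2 - x ^ 2 = (y - x) * (y + x)] is at
    least [(y - x) * (2 * l + 1)]. *)
Lemma sum_gap (A B : seq nat) l : size A = size B ->
  (forall j, (j < size B)%N -> (nth 0 A j < nth 0 B j)%N) -> all (leq l) A ->
  (size B + sumn A <= sumn B)%N /\
  ((\sum_(x <- A) x ^ 2) + (2 * l + 1) * sumn B <= (\sum_(x <- B) x ^ 2) + (2 * l + 1) * sumn A)%N.
Proof.
elim: A B => [|x A IH] [|y B] //=.
move=> [sz] lt /andP[lx lA]; rewrite !big_cons.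
have [|h1 h2] := IH B sz _ lA; first by move=> j jB; apply: (lt j.+1).
have xy : (x < y)%N := lt 0%N isT.
split; first by lia.
have : (x ^ 2 + (2 * l + 1) * y <= y ^ 2 + (2 * l + 1) * x)%N.
  have [u ->] : exists u, y = (x + u.+1)%N by exists (y - x).-1; lia.
  by rewrite -!mulnn; nia.
by rewrite !mulnDr; lia.
Qed.

(** The bound on the sums forces all gaps to be 1. *)
Lemma sum_gap_eq (A B : seq nat) v : size A = size B ->
  (forall j, (j < size B)%N -> (nth 0 A j < nth 0 B j)%N) ->
  (sumn B <= size B + sumn A)%N -> all (leq v.+1) B -> all (leq v) A.
Proof.
elim: A B => [|x A IH] [|y B] //= [sz] lt le_s /andP[vy vB].
have lt' j : (j < size B)%N -> (nth 0 A j < nth 0 B j)%N by move=> jB; apply: (lt j.+1).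
have xy : (x < y)%N := lt 0%N isT.
have [|h1 _] := @sum_gap A B 0 sz lt'; first exact/allP.
by apply/andP; split; [lia|apply: (IH B) => //; lia].
Qed.

Variables (m q : nat) (a : 'I_m -> nat) (b : 'I_q -> nat) (i0 : 'I_m).
Hypothesis min_a : forall i, (a i0 <= a i)%N.
Hypothesis qm : q.+1 = m.
Hypothesis sum_ab : (\sum_i a i = \sum_j b j)%N.
Hypothesis count_ab : forall v, (0 < #|[pred j | b j <= v]|)%N ->
  (#|[pred j | b j <= v]| < #|[pred i | a i < v]|)%N.

(** Once both families are sorted, [count_ab] says that the [j]-th element of [b]
    exceeds the [j.+1]-th element of [a], and [sum_gap] applies to the tail of [a]
    with [l] equal to [a i0], or to its successor if all gaps are 1. The gaps
    add up to [a i0], the element that is left over. *)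
Lemma degree_estimates : [/\ (q <= a i0)%N,
  (\sum_i a i ^ 2 + a i0 ^ 2 + a i0 <= \sum_j b j ^ 2)%N &
  (q = a i0 -> (forall j, a i0 + 2 <= b j)%N ->
   \sum_i a i ^ 2 + a i0 ^ 2 + 3 * a i0 <= \sum_j b j ^ 2)%N].
Proof.
pose As := sort leq (codom a); pose Bs := sort leq (codom b).
have sA : sorted leq As by apply: sort_sorted leq_total _.
have sB : sorted leq Bs by apply: sort_sorted leq_total _.
have szA : size As = q.+1 by rewrite size_sort size_codom card_ord.
have szB : size Bs = q by rewrite size_sort size_codom card_ord.
have sumE r (c : 'I_r -> nat) (F : nat -> nat) :
    (\sum_(x <- sort leq (codom c)) F x = \sum_i F (c i))%N.
  by rewrite (perm_big (codom c)) ?perm_sort //= big_map big_enum.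
have countE r (c : 'I_r -> nat) (P : pred nat) :
    count P (sort leq (codom c)) = #|[pred i | P (c i)]|.
  have /permP -> : perm_eq (sort leq (codom c)) (codom c) by rewrite perm_sort.
  rewrite count_map -size_filter cardE /enum_mem -filter_predI.
  by congr size; apply: eq_filter => i; rewrite /= !inE andbT.
have lt j : (j < q)%N -> (nth 0 As j.+1 < nth 0 Bs j)%N.
  rewrite -szB => jq; apply: sorted_count_lt => //.
  have jB := sorted_count_le sB jq; apply: leq_ltn_trans jB _.
  rewrite !countE; apply: count_ab; rewrite -(countE _ b (fun x => x <= nth 0 Bs j)%N).
  exact: leq_ltn_trans (sorted_count_le sB jq).
have [x [A AsE]] : exists x A, As = x :: A by case: (As) szA => // x A _; exists x, A.
move: sA szA lt; rewrite AsE => sA [szA] lt.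
have minx y : y \in x :: A -> (a i0 <= y)%N.
  by rewrite -AsE mem_sort => /codomP[i ->]; apply: min_a.
have xE : x = a i0.
  apply/eqP; rewrite eqn_leq minx ?mem_head // andbT.
  have : a i0 \in x :: A by rewrite -AsE mem_sort codom_f.
  rewrite inE => /orP[/eqP -> //|]; move: sA => /= /(order_path_min leq_trans)/allP h.
  exact: h.
have sz : size A = size Bs by rewrite szA szB.
have lt' j : (j < size Bs)%N -> (nth 0 A j < nth 0 Bs j)%N by rewrite szB => /lt.
have sumA F : (\sum_i F (a i) = F x + \sum_(y <- A) F y)%N by rewrite -sumE -/As AsE big_cons.
have sumB F : (\sum_j F (b j) = \sum_(y <- Bs) F y)%N by rewrite -sumE.
have sums : (x + sumn A = sumn Bs)%N by rewrite !sumnE -(sumA id) -(sumB id).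
rewrite (sumA (fun x => x ^ 2)%N) (sumB (fun x => x ^ 2)%N) -xE.
have [|h1 h2] := @sum_gap A Bs x sz lt'.
  by apply/allP => y yA; rewrite xE minx // inE yA orbT.
have le_q : (q <= x)%N by rewrite -szB; lia.
split=> //.
  move: h2; rewrite -sums -mulnn; nia.
move=> qx bx.
have [|_ h3] := @sum_gap A Bs x.+1 sz lt'.
  apply: (sum_gap_eq sz lt'); first by rewrite szB qx; lia.
  by apply/allP => y; rewrite mem_sort => /codomP[j ->]; have := bx j; lia.
by move: h3; rewrite -sums -mulnn; nia.
Qed.

End Numerics.

(** * Essential generators *)

(** A generator of degree 0 would be a unit, but [I] is proper. *)
Lemma min_gens_degree_gt0 (K : fieldType) n (I : idealr {mpoly K[n]}) N
    (f : 'I_N -> {mpoly K[n]}) a i : min_gens I f a -> (0 < a i)%N.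
Proof.
move=> minf; have [[fI fa _] _] := minf; rewrite lt0n; apply/eqP => ai.
have fiE : f i = ((f i)@_0%MM)%:MP.
  apply: msize1_polyC; rewrite msizeE; apply/bigmax_leqP_seq => b bs _.
  by rewrite (dhomog_mf (fa i) bs) ai.
have c0 : (f i)@_0%MM != 0.
  by apply: contraNneq (min_gens_neq0 minf i) => c0; rewrite fiE c0 mpolyC0.
have := idealMr (((f i)@_0%MM)^-1)%:MP (fI i).
by rewrite {2}fiE -mpolyCM mulVf // idealr1.
Qed.

Lemma moment_natE m q (a : 'I_m -> nat) (b : 'I_q -> nat) r : (0 < r)%N ->
  moment a b r = (\sum_j b j ^ r)%:R - (\sum_i a i ^ r)%:R.
Proof.
move=> r0; rewrite /moment expr0n (gtn_eqF r0) sub0r addrC !natr_sum.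
by congr (_ - _); apply: eq_bigr => i _; rewrite natrX.
Qed.

Theorem corollary3p2 (K : closedFieldType) (n : nat)
    (I : idealr {mpoly K[n]}) (e : rat) :
  homogeneous_ideal I ->
  perfect_of_height 2 I ->
  multiplicity I e ->
  e < n%:R * (n%:R + 3) / 2 ->
  exists2 B : seq {mpoly K[n]},
    standard_basis I B & {in B, forall f, essential B f}.
Proof.
move=> homI [htI [resI _]] mulI lt_e.
(* A proper ideal has growth 0, so height two requires two variables. *)
have := growth_ideal_height homI htI (growth0 (idealr_set I) _).
rewrite addn0 /= idealr1 => /(_ notF).
case: n I homI htI resI mulI lt_e => [|n] I homI htI resI mulI lt_e // _.
have [m [f1 [a min1]]] := exists_min_gens homI.
case: m f1 a min1 => [|m] f1 a min1.
  exists (gens_seq f1); first exact: min_gens_standard_basis min1.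
  by move=> p /mem_gens_seq[[]].
pose i0 := [arg min_(i < ord0) a i]%N.
have min_a i : (a i0 <= a i)%N by rewrite /i0; case: arg_minnP => // j _; apply.
have [f minf points] := min_gens_points min1 (min_gens_degree_gt0 i0 min1) min_a.
have [genI _] := minf.
have [q [z [b [genZ minZ]]]] :=
  exists_min_homgen (syzygies_submodule f) (syzygies_graded minf).
have relZ c := @min_homgen_rel _ _ _ _ _ _ _ _ c (conj genZ minZ).
have genI' p : p \in I <-> span_ideal f p.
  have [fI _ fgen] := genI; split=> [/fgen //|[c ->]].
  by apply: rpred_sum => i _; apply/idealMr/fI.
have freeZ := syzygies_free genI' genZ.1 relZ resI.
exists (gens_seq f); first exact: min_gens_standard_basis minf.
move=> _ /mem_gens_seq[i ->].
have [ai|/eqP ai] := eqVneq (a i) (a i0).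
  by have [x fx [l xl]] := points i ai; apply: essential_of_point fx xl.
move=> /(inessential_card minf genZ) card_i.
have [m0 m1] := moments_eq0 homI genI genZ freeZ htI.
have qm : q.+1 = m.+1.
  move: m0; rewrite /moment; under eq_bigr do rewrite expr0.
  under [X in _ + X]eq_bigr do rewrite expr0.
  rewrite !sumr_const !card_ord expr0 => /eqP.
  by rewrite addrAC subr_eq0 -mulrS eqr_nat => /eqP.
have sum_ab : (\sum_i a i = \sum_j b j)%N.
  move: m1; rewrite moment_natE // => /eqP; rewrite subr_eq0 eqr_nat => /eqP.
  by under eq_bigr do rewrite expn1; under [RHS]eq_bigr do rewrite expn1.
have [le_q sq1 sq2] :=
  degree_estimates min_a qm sum_ab (card_syzygies_lt minf genZ freeZ).
have a0 := min_gens_degree_gt0 i0 minf.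
have m2 : moment a b 2 != 0.
  by rewrite moment_natE // subr_eq0 eqr_nat; apply/eqP; lia.
have eE := multiplicity_moment homI genI genZ freeZ htI m2 mulI.
have lt_sq : (\sum_j b j ^ 2 < \sum_i a i ^ 2 + n.+1 * (n.+1 + 3))%N.
  rewrite -(ltr_nat rat) natrD natrM natrD.
  by move: lt_e; rewrite eE moment_natE //; lra.
have le_nq : (n.+1 <= q)%N.
  by apply: leq_trans card_i _; rewrite -[q in leqRHS]card_ord max_card.
have [lt_na|] := ltnP n.+1 (a i0).
  by move: sq1; rewrite -!mulnn in lt_sq *; nia.
move=> le_an; have qa : q = a i0 by lia.
have an : a i0 = n.+1 by lia.
have bj j : (a i0 + 2 <= b j)%N.
  have all_b : [pred j | (a i < b j)%N] =i predT.
    apply/subset_cardP; last exact/subset_predT.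
    apply/eqP; rewrite eqn_leq max_card card_ord; apply: leq_trans card_i.
    by rewrite -an -qa.
  have /= := all_b j; rewrite !inE => lt_ab.
  by have := min_a i; lia.
have := sq2 qa bj; rewrite an; move: lt_sq; rewrite -!mulnn; nia.
Qed.
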